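(* If $\pi$ is an orthogonal representation of $\mathbb{Z}$, then $M_\pi$ is a factor if and only if $\pi$ is faithful.
   Context: For a real Hilbert space $H$ with complexification $H_{\mathbb{C}}$, let $\mathbb{C}\Omega\oplus\bigoplus_{n\ge1}H_{\mathbb{C}}^{\otimes n}$ be the full Fock space, and for $\xi\in H$ let $\ell(\xi)$ be the left creation operator and $s(\xi)=\ell(\xi)+\ell(\xi)^*$. $\Gamma(H)''$ is the von Neumann algebra generated by $\{s(\xi):\xi\in H\}$, with faithful normal tracial state $\tau=\langle\,\cdot\,\Omega,\Omega\rangle$. An orthogonal representation $(\pi,H)$ of $\mathbb{Z}$ induces the trace preserving action of $\mathbb{Z}$ on $\Gamma(H)''$ determined by $n\cdot s(\xi)=s(\pi(n)\xi)$, and $M_\pi=\Gamma(H)''\rtimes\mathbb{Z}$ is the von Neumann algebraic crossed product. $\pi$ is faithful if $\pi(n)\neq\mathrm{id}$ for all $n\ne0$. *)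

(* Defs.v *)
From HB Require Import structures.
From mathcomp Require Import all_boot all_order all_algebra.
From mathcomp Require Import complex.
From mathcomp Require Import ring.
From mathcomp Require Import boolp classical_sets functions reals topology.
From mathcomp Require Import normedtype sequences.
Set Implicit Arguments.
Unset Strict Implicit.
Unset Printing Implicit Defensive.
Import Order.TTheory GRing.Theory Num.Theory.
Import numFieldNormedType.Exports.
Local Open Scope classical_set_scope.
Local Open Scope ring_scope.

(* The library has these structures on every abstract numClosedFieldType but
   does not declare them on the concrete type R[i]. *)
HB.instance Definition _ (R : realType) := NormedModule.copy R[i] R[i]^o.

Lemma complex_complete (R : realType) (F : set_system R[i]) :
  ProperFilter F -> cauchy F -> cvg F.
Proof.
move=> FF cF.
have h (f : R[i] -> R) :
    (forall x y, `|f x - f y|%:C%C <= `|x - y|) -> cvg (f @ F).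
  move=> hf; have PF : ProperFilter (f @ F) by exact: fmap_proper_filter.
  apply/(@cauchy_cvgP R (f @ F) PF).
  move/cauchy_ballP: cF => cF.
  apply/cauchy_ballP => e e0.
  have e0' : 0 < e%:C%C :> R[i] by rewrite ltcR.
  have [[A B] /= [FA FB] AB] := cF _ e0'.
  exists (f @` A, f @` B) => /=.
    by split; [apply: filterS FA|apply: filterS FB] => x Ax; exists x.
  move=> [_ _] /= [[x Ax <-] [y By <-]].
  have := AB (x, y) (conj Ax By).
  rewrite -!ball_normE /= => xy.
  by rewrite -ltcR; exact: le_lt_trans (hf x y) xy.
have norm_Im (x : R[i]) : `|complex.Im x|%:C%C <= `|x|.
  have -> : complex.Im x = - complex.Re (x * 'i%C).
    by rewrite complex.ReiNIm opprK.
  by rewrite normrN (le_trans (normc_ge_Re _))// normrM complexiE normCi mulr1.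
have ReB (x y : R[i]) : complex.Re x - complex.Re y = complex.Re (x - y).
  by case: x y => [? ?] [].
have ImB (x y : R[i]) : complex.Im x - complex.Im y = complex.Im (x - y).
  by case: x y => [? ?] [].
have hRe : cvg (@complex.Re R @ F).
  by apply: h => x y; rewrite ReB; exact: normc_ge_Re.
have hIm : cvg (@complex.Im R @ F).
  by apply: h => x y; rewrite ImB.
set a := lim _ in hRe; set b := lim _ in hIm.
apply/cvg_ex; exists (Complex a b); apply/cvgrPdist_lt => e e0.
have -> : e = (complex.Re e)%:C%C.
  by rewrite RRe_real // gtr0_real.
have e0' : 0 < complex.Re e / 2.
  by rewrite divr_gt0 //; move: e0; rewrite ltcE => /andP[].
move/cvgrPdist_lt: hRe => /(_ _ e0') hRe.
move/cvgrPdist_lt: hIm => /(_ _ e0') hIm.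
near=> z.
have z1 : `|a - complex.Re z| < complex.Re e / 2 by near: z.
have z2 : `|b - complex.Im z| < complex.Re e / 2 by near: z.
rewrite [Complex a b - z]complexE.
apply: le_lt_trans (ler_normD _ _) _.
rewrite normrM complexiE normCi mul1r !normc_def /= !expr0n /= !addr0.
rewrite !sqrtr_sqr -raddfD ltcR [ltRHS]splitr ltrD //.
  by move: z1; rewrite -(ReB (Complex a b)).
by move: z2; rewrite -(ImB (Complex a b)).
Unshelve. all: by end_near. Qed.

HB.instance Definition _ (R : realType) :=
  Uniform_isComplete.Build R[i] (@complex_complete R).

(* theta is idfun for real and conjugation for complex Hilbert spaces; inner is
   linear in its first argument. *)
HB.mixin Record NormedModule_isHilbert (K : numFieldType) (theta : K -> K) V
    & CompleteNormedModule K V := {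
  inner : V -> V -> K;
  inner_linear : forall z (a : K) x y,
    inner (a *: x + y) z = a * inner x z + inner y z;
  inner_sym : forall x y, inner y x = theta (inner x y);
  inner_norm : forall x, inner x x = `|x| ^+ 2
}.

#[short(type="hilbertType")]
HB.structure Definition Hilbert (K : numFieldType) (theta : K -> K) :=
  {V of CompleteNormedModule K V & NormedModule_isHilbert K theta V}.

Section ComplexLimits.
Context {R : realType} {T : Type} {F : set_system T} {FF : ProperFilter F}.
Implicit Types (u v : T -> R[i]) (a b : R[i]).

Lemma cvgC_cst a : (fun=> a) @ F --> a.
Proof. exact: cvg_cst. Qed.

Lemma cvgCD u v a b : u @ F --> a -> v @ F --> b ->
  (fun n => u n + v n) @ F --> a + b.
Proof. move=> ua vb; exact: (cvgD ua vb). Qed.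

Lemma cvgCB u v a b : u @ F --> a -> v @ F --> b ->
  (fun n => u n - v n) @ F --> a - b.
Proof. move=> ua vb; exact: (cvgB ua vb). Qed.

Lemma cvgCM u v a b : u @ F --> a -> v @ F --> b ->
  (fun n => u n * v n) @ F --> a * b.
Proof. move=> ua vb; exact: (cvgM ua vb). Qed.

Lemma cvgC_norm u a : u @ F --> a -> (fun n => `|u n|) @ F --> `|a|.
Proof. move=> ua; exact: (cvg_norm ua). Qed.

Lemma cvgC_conj u a : u @ F --> a -> (fun n => (u n)^*) @ F --> a^*.
Proof.
move=> /cvgrPdist_lt ua; apply/cvgrPdist_lt => e /ua.
by apply: filterS => n; rewrite -rmorphB norm_conjC.
Qed.

Lemma cvgC_unique u a b : u @ F --> a -> u @ F --> b -> a = b.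
Proof. move=> ua ub; exact: (cvg_unique _ ua ub). Qed.

Lemma cvgC_lim u a b : u @ F --> a -> a = b -> u @ F --> b.
Proof. by move=> + <-. Qed.

Lemma eq_cvgC u v a : (forall n, u n = v n) -> u @ F --> a -> v @ F --> a.
Proof. by move=> /funext ->. Qed.

End ComplexLimits.
Arguments cvgC_cst {R T F FF} a.

Lemma cvgC_harmonic (R : realType) :
  (fun n => n.+1%:R^-1 : R[i]) @ \oo --> (0 : R[i]).
Proof.
apply/cvgrPdist_lt => e e0; have er : e = (complex.Re e)%:C%C.
  by rewrite RRe_real // gtr0_real.
have := @cvg_harmonic R; move=> /cvgrPdist_lt /(_ (complex.Re e)).
rewrite -ltcR -er => /(_ e0); apply: filterS => n.
rewrite !sub0r !normrN !ger0_norm ?invr_ge0 // -ltcR -er /harmonic.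
by rewrite fmorphV rmorph_nat.
Qed.

(* The Hilbert space of a positive semidefinite kernel k on X: the separated
   completion of the formal combinations u of points of X for the semi-inner
   product gram.  It is realized inside X -> R[i], the vector f being the
   function x |-> <f, e_x>, where e_x is the vector of the point x and
   <e_x, e_y> = k x y. *)
Section KernelSpace.
Variables (R : realType) (X : choiceType) (k : X -> X -> R[i]).
Local Notation C := R[i].

Definition combine (u : seq (C * X)) : X -> C := \sum_(p <- u) p.1 *: k p.2.

Definition pairing (phi : X -> C) (v : seq (C * X)) : C :=
  \sum_(q <- v) q.1^* * phi q.2.

Definition gram u v := pairing (combine u) v.

Definition psd_kernel :=
  (forall x y, k y x = (k x y)^*) /\ forall u, 0 <= gram u u.

Hypothesis kpsd : psd_kernel.

Let scale (a : C) (u : seq (C * X)) := [seq (a * p.1, p.2) | p <- u].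

Lemma combineE u x : combine u x = \sum_(p <- u) p.1 * k p.2 x.
Proof. by rewrite /combine fct_sumE. Qed.

Lemma combine_cat u v : combine (u ++ v) = combine u + combine v.
Proof. exact: big_cat. Qed.

Lemma combine_scale a u : combine (scale a u) = a *: combine u.
Proof.
by rewrite /combine big_map scaler_sumr; apply: eq_bigr => p _; rewrite scalerA.
Qed.

Lemma pairing_cat phi u v : pairing phi (u ++ v) = pairing phi u + pairing phi v.
Proof. exact: big_cat. Qed.

Lemma pairing_scale phi a u : pairing phi (scale a u) = a^* * pairing phi u.
Proof.
rewrite /pairing big_map mulr_sumr; apply: eq_bigr => p _ /=.
by rewrite rmorphM mulrA.
Qed.

Lemma pairingD phi psi u : pairing (phi + psi) u = pairing phi u + pairing psi u.
Proof. by rewrite -big_split; apply: eq_bigr => p _; exact: mulrDr. Qed.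

Lemma pairingZ a phi u : pairing (a *: phi) u = a * pairing phi u.
Proof. by rewrite mulr_sumr; apply: eq_bigr => p _; exact: mulrCA. Qed.

Lemma pairingN phi u : pairing (- phi) u = - pairing phi u.
Proof. by rewrite -scaleN1r pairingZ mulN1r. Qed.

Lemma pairingB phi psi u : pairing (phi - psi) u = pairing phi u - pairing psi u.
Proof. by rewrite pairingD pairingN. Qed.

Lemma gram_sym u v : gram v u = (gram u v)^*.
Proof.
rewrite /gram /pairing rmorph_sum.
under eq_bigr do rewrite combineE mulr_sumr.
rewrite exchange_big; apply: eq_bigr => p _; rewrite rmorphM /= conjCK combineE.
rewrite rmorph_sum mulr_sumr; apply: eq_bigr => q _.
by rewrite rmorphM /= -(proj1 kpsd) mulrCA.
Qed.

Lemma gram_ge0 u : 0 <= gram u u. Proof. exact: (proj2 kpsd). Qed.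

Lemma gram_CS2 u v : `|gram u v| ^+ 2 <= gram u u * gram v v.
Proof.
have key t : 0 <= gram u u - t^* * gram u v - t * (gram u v)^*
                  + `|t| ^+ 2 * gram v v.
  have := gram_ge0 (u ++ scale (- t) v).
  rewrite /gram combine_cat pairing_cat !pairingD combine_scale !pairing_scale.
  rewrite !pairingZ -!/(gram _ _) (gram_sym u v) rmorphN /= normCK.
  congr (_ <= _); ring.
set b := gram u v in key *; set a := gram u u in key *.
have a0 : 0 <= a by exact: gram_ge0.
have ar : a^* = a by apply/CrealP/ger0_real.
have [v0|v0] := eqVneq (gram v v) 0.
  rewrite v0 mulr0; have [->|b0] := eqVneq b 0.
    by rewrite normr0 expr0n.
  have n0 : b * b^* != 0 by rewrite -normCK expf_eq0 normr_eq0.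
  have := key ((a + 1) / (b * b^* ) * b).
  rewrite v0 !rmorphM fmorphV rmorphM rmorphD rmorph1 /= conjCK ar.
  have -> : a - (a + 1) / (b^* * b) * b^* * b - (a + 1) / (b * b^* ) * b * b^*
     + `|(a + 1) / (b * b^* ) * b| ^+ 2 * 0 = - (a + 2).
    by field; move: n0; rewrite mulf_eq0 negb_or andbC.
  by rewrite oppr_ge0 => /(lt_le_trans (ltr_wpDl a0 (ltr0Sn _ 1))); rewrite ltxx.
have vgt0 : 0 < gram v v by rewrite lt_def v0 gram_ge0.
have := key (b / gram v v).
have vr : (gram v v)^* = gram v v by apply/CrealP/gtr0_real.
rewrite !normCK !rmorphM fmorphV /= vr.
have -> : a - b^* / gram v v * b - b / gram v v * b^* + b / gram v v *
  (b^* / gram v v) * gram v v = a - b * b^* / gram v v by field.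
by rewrite subr_ge0 ler_pdivrMr.
Qed.

Definition gnorm u := sqrtC (gram u u).

Lemma gnorm_ge0 u : 0 <= gnorm u. Proof. by rewrite sqrtC_ge0 gram_ge0. Qed.

Definition bounded_by (phi : X -> C) (e : C) :=
  forall v, `|pairing phi v| <= e * gnorm v.

Lemma combine_bounded u : bounded_by (combine u) (gnorm u).
Proof.
move=> v; rewrite -(@ler_pXn2r _ 2) ?nnegrE ?mulr_ge0 ?gnorm_ge0 //.
by rewrite exprMn !sqrtCK; exact: gram_CS2.
Qed.

Lemma gnorm_le u e : 0 <= e -> bounded_by (combine u) e -> gnorm u <= e.
Proof.
move=> e0 /(_ u).
rewrite -/(gram u u) ger0_norm ?gram_ge0 // -[gram u u]sqrtCK expr2.
have [->//|n0] := eqVneq (gnorm u) 0.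
by rewrite -/(gnorm u) ler_pM2r // lt_def n0 gnorm_ge0.
Qed.

Lemma bounded_byD phi psi e d :
  bounded_by phi e -> bounded_by psi d -> bounded_by (phi + psi) (e + d).
Proof.
move=> he hd v; rewrite pairingD mulrDl.
by rewrite (le_trans (ler_normD _ _)) // lerD.
Qed.

Lemma bounded_byZ a phi e : bounded_by phi e -> bounded_by (a *: phi) (`|a| * e).
Proof. by move=> he v; rewrite pairingZ normrM -mulrA ler_wpM2l. Qed.

Lemma bounded_byN phi e : bounded_by phi e -> bounded_by (- phi) e.
Proof. by move=> he v; rewrite pairingN normrN. Qed.

Lemma bounded_byB phi psi e d :
  bounded_by phi e -> bounded_by psi d -> bounded_by (phi - psi) (e + d).
Proof. by move=> he hd; apply: bounded_byD => //; exact: bounded_byN. Qed.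

Lemma bounded_by_le phi e d : e <= d -> bounded_by phi e -> bounded_by phi d.
Proof. by move=> ed he v; rewrite (le_trans (he v)) // ler_wpM2r // gnorm_ge0. Qed.

Definition approximates (u : nat -> seq (C * X)) (phi : X -> C) :=
  exists2 e : nat -> C, e @ \oo --> (0 : C) &
    forall n, 0 <= e n /\ bounded_by (phi - combine (u n)) (e n).

Definition kernel_limit : {pred X -> C} :=
  [pred phi | `[< exists u, approximates u phi >]].

Lemma kernel_limitP phi :
  reflect (exists u, approximates u phi) (phi \in kernel_limit).
Proof. exact: asboolP. Qed.

Lemma approximatesD u v phi psi : approximates u phi -> approximates v psi ->
  approximates (fun n => u n ++ v n) (phi + psi).
Proof.
move=> [e e0 he] [d d0 hd]; exists (fun n => e n + d n).
  exact: cvgC_lim (cvgCD e0 d0) (addr0 _).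
move=> n; have [[e1 e2] [d1 d2]] := (he n, hd n); rewrite addr_ge0 //; split=> //.
by rewrite combine_cat opprD addrACA; exact: bounded_byD.
Qed.

Lemma approximatesZ a u phi : approximates u phi ->
  approximates (fun n => scale a (u n)) (a *: phi).
Proof.
move=> [e e0 he]; exists (fun n => `|a| * e n).
  exact: cvgC_lim (cvgCM (cvgC_cst `|a|) e0) (mulr0 _).
move=> n; have [e1 e2] := he n; rewrite mulr_ge0 //; split=> //.
by rewrite combine_scale -scalerBr; exact: bounded_byZ.
Qed.

Lemma approximates_combine u : approximates (fun=> u) (combine u).
Proof.
exists (fun=> 0); first exact: cvgC_cst.
move=> n; split=> // v; rewrite subrr mul0r.
by rewrite /pairing big1 ?normr0 // => p _; rewrite mulr0.
Qed.

Lemma kernel_limit_submod : submod_closed kernel_limit.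
Proof.
split.
  apply/kernel_limitP; exists (fun=> [::]).
  by have := approximates_combine [::]; rewrite /combine big_nil.
move=> a phi psi /kernel_limitP[u hu] /kernel_limitP[v hv].
apply/kernel_limitP; exists (fun n => scale a (u n) ++ v n).
by apply: approximatesD => //; exact: approximatesZ.
Qed.
HB.instance Definition _ := GRing.isSubmodClosed.Build C (X -> C) kernel_limit
  kernel_limit_submod.

Lemma squeeze0 (u e : nat -> C) : (forall n, `|u n| <= e n) ->
  e @ \oo --> (0 : C) -> u @ \oo --> (0 : C).
Proof.
move=> ue /cvgrPdist_lt e0; apply/cvgrPdist_lt => d d0.
near=> n; rewrite sub0r normrN (le_lt_trans (ue n)) //.
have : `|0 - e n| < d by near: n; exact: e0.
by rewrite sub0r normrN ger0_norm // (le_trans _ (ue n)).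
Unshelve. all: by end_near. Qed.

Lemma lim_ge0C (u : nat -> C) a : (forall n, 0 <= u n) -> u @ \oo --> a -> 0 <= a.
Proof.
move=> u0 ua; suff -> : a = `|a| by [].
apply: (cvgC_unique ua); apply: eq_cvgC (cvgC_norm ua) => n.
by rewrite ger0_norm.
Qed.

Lemma lim_leC (u v : nat -> C) a b : (forall n, u n <= v n) ->
  u @ \oo --> a -> v @ \oo --> b -> a <= b.
Proof.
move=> uv ua vb; rewrite -subr_ge0; apply: lim_ge0C (cvgCB vb ua) => n.
by rewrite subr_ge0.
Qed.

Lemma pairing_diff phi e u v : bounded_by phi e -> 0 <= e ->
  forall d, 0 <= d -> bounded_by (combine u - combine v) d ->
  `|pairing phi u - pairing phi v| <= e * d.
Proof.
move=> he e0 d d0; have -> : combine u - combine v = combine (u ++ scale (- 1) v).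
  by rewrite combine_cat combine_scale scaleN1r.
move=> /(gnorm_le d0) h.
have -> : pairing phi u - pairing phi v = pairing phi (u ++ scale (-1) v).
  by rewrite pairing_cat pairing_scale rmorphN rmorph1 mulN1r.
by rewrite (le_trans (he _)) // ler_wpM2l.
Qed.
Lemma approximates_bounded u phi : approximates u phi ->
  exists2 M, 0 <= M & bounded_by phi M.
Proof.
move=> [e _ /(_ 0)[e0 he]]; exists (e 0 + gnorm (u 0)).
  by rewrite addr_ge0 ?gnorm_ge0.
by rewrite -[phi](subrK (combine (u 0))); exact: bounded_byD he (combine_bounded _).
Qed.

Lemma approximates_diff u v phi : approximates u phi -> approximates v phi ->
  exists2 e : nat -> C, e @ \oo --> (0 : C) & forall n m, 0 <= e n /\
    bounded_by (combine (u n) - combine (v m)) (e n + e m).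
Proof.
move=> [e e0 he] [d d0 hd]; exists (fun n => e n + d n).
  exact: cvgC_lim (cvgCD e0 d0) (addr0 _).
move=> n m; have [[e1 e2] [d1 d2]] := (he n, hd m).
have [_ ?] := he m; have [? _] := hd n; rewrite addr_ge0 //; split=> //.
have -> : combine (u n) - combine (v m) =
    (phi - combine (v m)) - (phi - combine (u n)).
  by rewrite opprB [RHS]addrC addrA subrK.
apply: bounded_by_le (bounded_byB d2 e2).
rewrite addrC lerD //; first by rewrite lerDl.
by rewrite lerDr; case: (he m).
Qed.

Lemma approximates_cvg u phi psi M : 0 <= M -> bounded_by phi M ->
  approximates u psi -> cvg (pairing phi (u n) @[n --> \oo]).
Proof.
move=> M0 hM hu; have [e e0 he] := approximates_diff hu hu.
apply/cauchy_cvgP/cauchy_ballP => r r0.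
have d0 : 0 < r / (M + 1) / 2 by rewrite !divr_gt0 // ltr_wpDl.
move/cvgrPdist_lt: e0 => /(_ _ d0) He.
pose A := [set x | exists2 n, e n < r / (M + 1) / 2 & x = pairing phi (u n)].
exists (A, A) => /=.
  suff FA : \forall n \near \oo, A (pairing phi (u n)) by [].
  near=> n; exists n => //.
  have : `|0 - e n| < r / (M + 1) / 2 by near: n.
  by rewrite sub0r normrN ger0_norm //; case: (he n n).
move=> [_ _] /= [[n hn ->] [m hm ->]]; rewrite -ball_normE /=.
have [en hnm] := he n m; have [em _] := he m m.
have /le_lt_trans := pairing_diff hM M0 (addr_ge0 en em) hnm; apply.
rewrite (@le_lt_trans _ _ ((M + 1) * (e n + e m))) ?ler_wpM2r ?addr_ge0 ?lerDl //.
by rewrite -ltr_pdivlMl ?ltr_wpDl // mulrC [ltRHS]splitr ltrD.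
Unshelve. all: by end_near. Qed.

Definition klim phi u : C := lim (pairing phi (u n) @[n --> \oo]).

Lemma approximates_cvg2 u v phi psi M : 0 <= M -> bounded_by phi M ->
  approximates u psi -> approximates v psi ->
  pairing phi (u n) @[n --> \oo] --> klim phi v.
Proof.
move=> M0 hM hu hv; have cv := approximates_cvg M0 hM hv.
have [e e0 he] := approximates_diff hu hv.
have : (pairing phi (u n) - pairing phi (v n)) @[n --> \oo] --> (0 : C).
  apply: (@squeeze0 _ (fun n => M * (e n + e n))).
    move=> n; have [en ?] := he n n.
    by apply: pairing_diff => //; rewrite addr_ge0.
  by apply: cvgC_lim (cvgCM (cvgC_cst M) (cvgCD e0 e0)) _; rewrite addr0 mulr0.
move=> h; apply: eq_cvgC (cvgC_lim (cvgCD h cv) (add0r _)) => n.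
  by rewrite subrK.
Qed.

(* the limit does not depend on the approximating sequence *)
Definition kernel_inner phi psi : C :=
  klim phi (xget (fun=> [::]) [set u | approximates u psi]).

Lemma kernel_inner_cvg u phi psi : phi \in kernel_limit -> approximates u psi ->
  pairing phi (u n) @[n --> \oo] --> kernel_inner phi psi.
Proof.
move=> /kernel_limitP[w /approximates_bounded[M M0 hM]] hu.
apply: (approximates_cvg2 M0 hM hu).
exact: (@xgetPex _ (fun=> [::]) [set w | approximates w psi] (ex_intro _ u hu)).
Qed.

Lemma kernel_inner_linear psi a phi phi' : psi \in kernel_limit ->
  phi \in kernel_limit -> phi' \in kernel_limit ->
  kernel_inner (a *: phi + phi') psi =
  a * kernel_inner phi psi + kernel_inner phi' psi.
Proof.
move=> /kernel_limitP[u hu] h1 h2.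
apply: cvgC_unique (kernel_inner_cvg (rpredD (rpredZ a h1) h2) hu) _.
under eq_fun do rewrite pairingD pairingZ.
exact: cvgCD (cvgCM (cvgC_cst a) (kernel_inner_cvg h1 hu))
             (kernel_inner_cvg h2 hu).
Qed.

Lemma gnorm_bounded u phi : approximates u phi ->
  exists2 M, 0 <= M & forall n, gnorm (u n) <= M.
Proof.
move=> hu; have [M M0 hM] := approximates_bounded hu.
have [e e0 he] := hu.
have /cvg_seq_bounded[B [Br hB]] : cvgn e by apply/cvg_ex; exists 0.
have hB' n : e n <= `|B| + 1.
  have [en _] := he n.
  rewrite -(ger0_norm en); apply: hB => //.
  by rewrite (le_lt_trans (real_ler_norm Br)) // ltrDl.
exists (M + (`|B| + 1)) => [|n]; first by rewrite !addr_ge0.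
have [en hen] := he n.
rewrite (@le_trans _ _ (M + e n)) ?lerD2l //.
apply: gnorm_le; first by rewrite addr_ge0.
by rewrite -[combine _](subKr phi); exact: bounded_byB.
Qed.

Lemma gram_cvg u v phi psi : approximates u phi -> approximates v psi ->
  gram (u n) (v n) @[n --> \oo] --> kernel_inner phi psi.
Proof.
move=> hu hv.
have hphi : phi \in kernel_limit by apply/kernel_limitP; exists u.
have [M M0 hM] := gnorm_bounded hv.
have [e e0 he] := hu.
have : (gram (u n) (v n) - pairing phi (v n)) @[n --> \oo] --> (0 : C).
  apply: (@squeeze0 _ (fun n => e n * M)).
    move=> n; have [en hen] := he n.
    rewrite distrC /gram -pairingB (le_trans (hen _)) // ler_wpM2l //.
  exact: cvgC_lim (cvgCM e0 (cvgC_cst M)) (mul0r _).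
move=> h; apply: eq_cvgC (cvgC_lim (cvgCD h (kernel_inner_cvg hphi hv)) (add0r _)) => n.
  by rewrite subrK.
Qed.

Lemma kernel_inner_sym phi psi : phi \in kernel_limit -> psi \in kernel_limit ->
  kernel_inner psi phi = (kernel_inner phi psi)^*.
Proof.
move=> /kernel_limitP[u hu] /kernel_limitP[v hv].
apply: cvgC_unique (gram_cvg hv hu) _.
under eq_fun do rewrite gram_sym.
exact: cvgC_conj (gram_cvg hu hv).
Qed.

Lemma kernel_inner_ge0 phi : phi \in kernel_limit -> 0 <= kernel_inner phi phi.
Proof.
move=> /kernel_limitP[u hu]; apply: lim_ge0C (gram_cvg hu hu) => n.
exact: gram_ge0.
Qed.

Definition kernel_norm phi : C := sqrtC (kernel_inner phi phi).

Lemma kernel_norm_bounded phi : phi \in kernel_limit ->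
  bounded_by phi (kernel_norm phi).
Proof.
move=> hphi v; have /kernel_limitP[u hu] := hphi.
have sq0 : 0 <= kernel_norm phi by rewrite sqrtC_ge0 kernel_inner_ge0.
rewrite -(@ler_pXn2r _ 2) ?nnegrE ?mulr_ge0 ?gnorm_ge0 //.
rewrite exprMn !sqrtCK.
have cv : gram (u n) v @[n --> \oo] --> pairing phi v.
  have [e e0 he] := hu.
  have : (gram (u n) v - pairing phi v) @[n --> \oo] --> (0 : C).
    apply: (@squeeze0 _ (fun n => e n * gnorm v)).
      by move=> n; have [en hen] := he n; rewrite distrC /gram -pairingB.
    exact: cvgC_lim (cvgCM e0 (cvgC_cst (gnorm v))) (mul0r _).
  move=> h; apply: eq_cvgC (cvgC_lim (cvgCD h (cvgC_cst (pairing phi v))) (add0r _)) => n.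
  by rewrite subrK.
have cv2 : `|gram (u n) v| ^+ 2 @[n --> \oo] --> `|pairing phi v| ^+ 2.
  exact: cvgCM (cvgC_norm cv) (cvgC_norm cv).
apply: lim_leC cv2 (cvgCM (gram_cvg hu hu) (cvgC_cst (gram v v))) => n.
exact: gram_CS2.
Qed.

Lemma kernel_norm_le phi e : phi \in kernel_limit -> 0 <= e ->
  bounded_by phi e -> kernel_norm phi <= e.
Proof.
move=> hphi e0 he; have /kernel_limitP[u hu] := hphi.
have i0 := kernel_inner_ge0 hphi.
have cv := kernel_inner_cvg hphi hu.
have cv2 : `|pairing phi (u n)| ^+ 2 @[n --> \oo] --> kernel_inner phi phi ^+ 2.
  rewrite -(ger0_norm i0).
  exact: cvgCM (cvgC_norm cv) (cvgC_norm cv).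
have : kernel_inner phi phi ^+ 2 <= e ^+ 2 * kernel_inner phi phi.
  apply: lim_leC cv2 (cvgCM (cvgC_cst (e ^+ 2)) (gram_cvg hu hu)) => n /=.
  rewrite -[gram _ _]sqrtCK -exprMn ler_pXn2r ?nnegrE ?mulr_ge0 //.
  exact: gnorm_ge0.
have [i1|n0] := eqVneq (kernel_inner phi phi) 0.
  by rewrite /kernel_norm i1 sqrtC0.
rewrite expr2 ler_pM2r ?lt_def ?n0 // => h.
rewrite -(@ler_pXn2r _ 2) ?nnegrE ?sqrtC_ge0 //.
by rewrite sqrtCK.
Qed.

End KernelSpace.

Record psdKernel (R : realType) (X : choiceType) := PsdKernel {
  psd_fun :> X -> X -> R[i];
  psdP : psd_kernel psd_fun }.

Record kernel_space (R : realType) (X : choiceType) (k : psdKernel R X) :=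
  KernelSpace {
  kernel_fun : X -> R[i];
  kernel_funP : kernel_fun \in kernel_limit k }.

Section KernelSpaceStructure.
Variables (R : realType) (X : choiceType) (k : psdKernel R X).
Local Notation C := R[i].
Local Notation V := (kernel_space k).

HB.instance Definition _ := [isSub for @kernel_fun R X k].
HB.instance Definition _ := [Choice of V by <:].
HB.instance Definition _ := [SubChoice_isSubLmodule of V by <:].

Let norm (x : V) : C := kernel_norm k (\val x).

Let norm_ge0 x : 0 <= norm x.
Proof. rewrite sqrtC_ge0; exact: (kernel_inner_ge0 (psdP k) (kernel_funP x)). Qed.

Let norm_bounded x : bounded_by k (\val x) (norm x).
Proof. by apply: kernel_norm_bounded; [exact: psdP | exact: kernel_funP]. Qed.

Let norm_le (x : V) e : 0 <= e -> bounded_by k (\val x) e -> norm x <= e.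
Proof. by apply: kernel_norm_le; [exact: psdP | exact: kernel_funP]. Qed.

Let normD x y : norm (x + y) <= norm x + norm y.
Proof. by apply: norm_le; [exact: addr_ge0 | exact: bounded_byD]. Qed.

Let normZ_le a x : norm (a *: x) <= `|a| * norm x.
Proof. by apply: norm_le; [exact: mulr_ge0 | exact: bounded_byZ]. Qed.

Let normZ a x : norm (a *: x) = `|a| * norm x.
Proof.
have [->|a0] := eqVneq a 0.
  rewrite normr0 mul0r; apply/eqP; rewrite eq_le norm_ge0 andbT.
  by rewrite (le_trans (normZ_le _ _)) // normr0 mul0r.
apply/eqP; rewrite eq_le normZ_le /=.
rewrite -ler_pdivlMl ?normr_gt0 // -normfV -[x in leLHS](scalerK a0).
exact: normZ_le.
Qed.

Lemma pairing1 phi (y : X) : pairing phi [:: (1 : C, y)] = phi y.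
Proof. by rewrite /pairing big_seq1 rmorph1 mul1r. Qed.

Let norm_eq0 x : norm x = 0 -> x = 0.
Proof.
move=> x0; apply/val_inj/funext => y.
have := norm_bounded x [:: (1, y)]; rewrite x0 mul0r normr_le0 => /eqP.
by rewrite pairing1.
Qed.

HB.instance Definition _ := Lmodule_isNormed.Build C V normD normZ norm_eq0.

Lemma kernel_space_complete (F : set_system V) :
  ProperFilter F -> cauchy F -> cvg F.
Proof.
move=> FF /cauchy_ballP cF.
have norm1 y : 0 <= gnorm k [:: (1, y)] by apply: gnorm_ge0; exact: psdP.
have evB (x y : V) z : `|\val x z - \val y z| <= `|x - y| * gnorm k [:: (1, z)].
  by have := norm_bounded (x - y) [:: (1, z)]; rewrite pairing1.
have cev z : cvg ((fun x : V => \val x z) @ F).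
  have PF : ProperFilter ((fun x : V => \val x z) @ F) by exact: fmap_proper_filter.
  apply/cauchy_cvgP/cauchy_ballP => e e0.
  set g := gnorm k [:: (1, z)].
  have g0 : 0 <= g by exact: norm1.
  have d0 : 0 < e / (g + 1) by rewrite divr_gt0 // ltr_wpDl.
  have [[A B] /= [FA FB] AB] := cF _ d0.
  exists ((fun x : V => \val x z) @` A, (fun x : V => \val x z) @` B) => /=.
    by split; [apply: filterS FA|apply: filterS FB] => x Ax; exists x.
  move=> [_ _] /= [[x Ax <-] [y By <-]].
  have := AB (x, y) (conj Ax By); rewrite -!ball_normE /= => xy.
  rewrite (le_lt_trans (evB _ _ _)) // -/g.
  rewrite (@le_lt_trans _ _ (`|x - y| * (g + 1))) ?ler_wpM2l ?lerDl //.
  by rewrite -ltr_pdivlMr ?ltr_wpDl.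
pose phi z : C := lim ((fun x : V => \val x z) @ F).
have phiP v : (fun x : V => pairing (\val x) v) @ F --> pairing phi v.
  elim: v => [|p v IH].
    rewrite /pairing big_nil; under eq_fun do rewrite big_nil; exact: cvg_cst.
  rewrite /pairing big_cons; under eq_fun do rewrite big_cons.
  exact: cvgCD (cvgCM (cvgC_cst p.1^* ) (cev p.2)) IH.
have close e : 0 < e -> exists2 A, F A &
    forall x, A x -> bounded_by k (\val x - phi) e.
  move=> e0; have [[A B] /= [FA FB] AB] := cF _ e0.
  exists A => // x Ax v.
  have cv : (fun y : V => `|pairing (\val x) v - pairing (\val y) v|) @ F -->
      `|pairing (\val x) v - pairing phi v|.
    exact: cvgC_norm (cvgCB (cvgC_cst _) (phiP v)).

  rewrite pairingB; set l := `|_ - _| in cv *.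
  have : \forall y \near F, `|pairing (\val x) v - pairing (\val y) v| <= e * gnorm k v.
    apply: filterS FB => y By; rewrite -pairingB.
    have := AB (x, y) (conj Ax By); rewrite -!ball_normE /= => xy.
    apply: le_trans (norm_bounded (x - y) v) _.
    by apply: ler_wpM2r; [apply: gnorm_ge0; exact: psdP | exact: ltW].
  move=> near_le.
  have lr : l \is Num.real by exact: normr_real.
  have br : e * gnorm k v \is Num.real.
    by apply/ger0_real/mulr_ge0; [exact: ltW | apply: gnorm_ge0; exact: psdP].
  rewrite real_leNgt //; apply/negP => lt.
  move/cvgrPdist_lt: cv => /(_ (l - e * gnorm k v)); rewrite subr_gt0 => /(_ lt) h.
  have [y [h1 h2]] := filter_ex (filterI near_le h).
  have {}h2 : l - `|pairing (\val x) v - pairing (\val y) v| < l - e * gnorm k v.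
    by apply: le_lt_trans h2; rewrite real_ler_norm // realB // normr_real.
  by move: h2; rewrite ltrD2l ltrN2 => /lt_le_trans /(_ h1); rewrite ltxx.
have phiV : phi \in kernel_limit k.
  pose e (n : nat) : C := n.+1%:R^-1.
  have e0 n : 0 < e n by rewrite invr_gt0 ltr0Sn.
  have he n : exists u, bounded_by k (phi - combine k u) (e n).
    have [A FA hA] := close _ (divr_gt0 (e0 n) (ltr0Sn _ 1)).
    have [x Ax] := filter_ex FA.
    have /kernel_limitP[w [d d0 hd]] := kernel_funP x.
    have d1 := divr_gt0 (e0 n) (ltr0Sn C 1).
    move/cvgrPdist_lt: d0 => /(_ _ d1) d0.
    have [m] := filter_ex d0.
    have [dm0 dm] := hd m.
    rewrite sub0r normrN ger0_norm // => /ltW dm2.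
    exists (w m); have -> : phi - combine k (w m) =
        (\val x - combine k (w m)) - (\val x - phi).
      by rewrite opprB [RHS]addrC addrA subrK.
    rewrite [e n]splitr; apply: bounded_byB; last exact: hA.
    by apply: bounded_by_le dm; [exact: psdP | exact: dm2].
  apply/kernel_limitP; exists (fun n => projT1 (cid (he n))); exists e.
    exact: cvgC_harmonic.
  by move=> n; split; [exact: ltW | exact: projT2 (cid (he n))].
apply/cvg_ex; exists (KernelSpace phiV).
apply/cvgrPdist_le => e e0.
have [A FA hA] := close _ e0.
apply: filterS FA => x Ax; rewrite distrC; apply: norm_le; first exact: ltW.
exact: hA.
Qed.

HB.instance Definition _ := Uniform_isComplete.Build V kernel_space_complete.

Let kinner (x y : V) : C := kernel_inner k (\val x) (\val y).

Let kinner_linear z a x y : kinner (a *: x + y) z = a * kinner x z + kinner y z.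
Proof.
apply: kernel_inner_linear; [exact: psdP | exact: kernel_funP ..].
Qed.

Let kinner_sym x y : kinner y x = (kinner x y)^*.
Proof. apply: kernel_inner_sym; [exact: psdP | exact: kernel_funP ..]. Qed.

Let kinner_norm x : kinner x x = `|x| ^+ 2.
Proof. by rewrite sqrtCK. Qed.

HB.instance Definition _ := NormedModule_isHilbert.Build C (@Num.conj C) V
  kinner_linear kinner_sym kinner_norm.

Lemma kernel_vec_subproof x : k x \in kernel_limit k.
Proof.
apply/kernel_limitP; exists (fun=> [:: (1, x)]).
suff -> : (k x : X -> C) = combine k [:: (1, x)].
  by apply: approximates_combine; exact: psdP.
by rewrite /combine big_seq1 scale1r.
Qed.

Definition kernel_vec x : V := KernelSpace (kernel_vec_subproof x).

Lemma inner_kernel_vec (x : V) y : inner x (kernel_vec y) = kernel_fun x y.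
Proof.
have ky : approximates k (fun=> [:: (1, y)]) (k y).
  suff -> : (k y : X -> C) = combine k [:: (1, y)].
    by apply: approximates_combine; exact: psdP.
  by rewrite /combine big_seq1 scale1r.
have := kernel_inner_cvg (psdP k) (kernel_funP x) ky.
rewrite pairing1 => h; exact: cvgC_unique h (cvgC_cst _).
Qed.

Lemma kernel_vecE x y : inner (kernel_vec x) (kernel_vec y) = k x y.
Proof. exact: inner_kernel_vec. Qed.

Lemma kernel_vec_dense (x : V) (e : R) : 0 < e ->
  exists u : seq (C * X), `|x - \sum_(p <- u) p.1 *: kernel_vec p.2| < e%:C%C.
Proof.
move=> e0; have /kernel_limitP[u [d d0 hd]] := kernel_funP x.
have e0' : 0 < e%:C%C :> C by rewrite ltcR.
move/cvgrPdist_lt: d0 => /(_ _ e0') /filter_ex[n].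
have [dn0 dn] := hd n; rewrite sub0r normrN ger0_norm // => dne.
exists (u n); apply: le_lt_trans dne; apply: norm_le => //.
by rewrite raddfB raddf_sum.
Qed.

End KernelSpaceStructure.

Section PsdKernels.
Variable R : realType.
Local Notation C := R[i].

Lemma gramE (X : choiceType) (k : X -> X -> C) u v :
  gram k u v = \sum_(p <- u) \sum_(q <- v) p.1 * q.1^* * k p.2 q.2.
Proof.
rewrite /gram /pairing.
under eq_bigr do rewrite combineE mulr_sumr.
rewrite exchange_big; apply: eq_bigr => p _; apply: eq_bigr => q _.
by rewrite mulrCA mulrA.
Qed.

Lemma psd_form (V : lmodType C) (f : V -> V -> C) :
  (forall z a x y, f (a *: x + y) z = a * f x z + f y z) ->
  (forall x y, f y x = (f x y)^*) -> (forall x, 0 <= f x x) ->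
  psd_kernel f.
Proof.
move=> flin fsym f0; split=> // u.
have f0l z : f 0 z = 0.
  have := flin z 1 0 0; rewrite scale1r addr0 mul1r => /eqP.
  by rewrite -subr_eq subrr eq_sym => /eqP.
have fsum z (v : seq (C * V)) :
    f (\sum_(p <- v) p.1 *: p.2) z = \sum_(p <- v) p.1 * f p.2 z.
  by elim: v => [|p v IH]; rewrite ?big_nil // !big_cons flin IH.
have -> : gram f u u = f (\sum_(p <- u) p.1 *: p.2) (\sum_(p <- u) p.1 *: p.2).
  rewrite gramE fsum; apply: eq_bigr => p _.
  rewrite fsym fsum rmorph_sum mulr_sumr; apply: eq_bigr => q _.
  by rewrite rmorphM /= -fsym mulrA.
exact: f0.
Qed.

Lemma psd_delta (X : choiceType) : psd_kernel (fun x y : X => (x == y)%:R : C).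
Proof.
split=> [x y|u]; first by rewrite eq_sym conjC_nat.
pose a (p : C * X) z := p.1 * (p.2 == z)%:R : C.
have -> : gram (fun x y : X => (x == y)%:R : C) u u =
   \sum_(z <- undup (unzip2 u)) `|\sum_(p <- u) a p z| ^+ 2.
  under [RHS]eq_bigr do rewrite normCK rmorph_sum big_distrl /=.
  rewrite gramE [RHS]exchange_big /= [LHS]big_seq [RHS]big_seq.
  apply: eq_bigr => p pu.
  rewrite (bigD1_seq p.2) ?undup_uniq ?mem_undup ?map_f //= [X in _ + X]big1.
    rewrite addr0 mulr_sumr; apply: eq_bigr => q _.
    by rewrite /a eqxx mulr1 rmorphM /= conjC_nat eq_sym mulrA.
  by move=> z; rewrite /a eq_sym => /negPf ->; rewrite mulr0 mul0r.
by apply: sumr_ge0 => z _; exact: exprn_ge0.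
Qed.

Lemma psd_add (X : choiceType) (k1 k2 : X -> X -> C) :
  psd_kernel k1 -> psd_kernel k2 -> psd_kernel (fun x y => k1 x y + k2 x y).
Proof.
move=> [s1 p1] [s2 p2]; split=> [x y|u]; first by rewrite rmorphD s1 s2.
suff -> : gram (fun x y => k1 x y + k2 x y) u u = gram k1 u u + gram k2 u u.
  exact: addr_ge0.
rewrite !gramE -big_split; apply: eq_bigr => p _.
by rewrite -big_split; apply: eq_bigr => q _; rewrite mulrDr.
Qed.

Definition opt_kernel (X Y : Type) (g : X -> option Y) (k : Y -> Y -> C) x x' :=
  if (g x, g x') is (Some y, Some y') then k y y' else 0.

Lemma psd_opt (X Y : choiceType) (g : X -> option Y) (k : Y -> Y -> C) :
  psd_kernel k -> psd_kernel (opt_kernel g k).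
Proof.
move=> [s p]; split=> [x y|u].
  by rewrite /opt_kernel; case: (g x) (g y) => [a|] [b|] //; rewrite ?conjC0.
pose h (p : C * X) := omap (fun y => (p.1, y)) (g p.2).
suff -> : gram (opt_kernel g k) u u = gram k (pmap h u) (pmap h u) by [].
suff gE : forall v w, gram (opt_kernel g k) v w = gram k (pmap h v) (pmap h w) by [].
move=> v w; rewrite !gramE; elim: v => [|a v IH]; rewrite ?big_nil // big_cons IH /=.
rewrite /h; case ga: (g a.2) => [y|] /=.
  rewrite big_cons; congr (_ + _).
  elim: w {IH} => [|b w IH]; rewrite ?big_nil // big_cons IH /=.
  rewrite /opt_kernel ga; case: (g b.2) => [z|] /=; first by rewrite big_cons.
  by rewrite mulr0 add0r.
by rewrite big1 ?add0r // => q _; rewrite /opt_kernel ga mulr0.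
Qed.

Lemma psd_matrix n (A : 'M[C]_n) : (forall i j, A j i = (A i j)^*) ->
  (forall c : 'I_n -> C, 0 <= \sum_i \sum_j c i * (c j)^* * A i j) ->
  exists B : 'M[C]_n, forall i j, A i j = \sum_l B i l * (B j l)^*.
Proof.
move=> Asym Apos.
have Aherm : A \is hermsymmx.
  apply/is_hermitianmxP; rewrite expr0 scale1r; apply/matrixP => i j.
  by rewrite !mxE Asym.
have /orthomx_spectralP := hermitian_normalmx Aherm.
set P := spectralmx A; set d := spectral_diag A => AE.
have Pu : P \is unitarymx by exact: spectral_unitarymx.
have AE' i j : A i j = \sum_l (P l i)^* * d 0 l * P l j.
  rewrite {1}AE (invmx_unitary Pu) mxE; apply: eq_bigr => l _.
  by rewrite mul_mx_diag !mxE.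
have d0 l : 0 <= d 0 l.
  have <- : (P *m A *m invmx P) l l = d 0 l.
    rewrite {1}AE !mulmxA mulmxV ?unitarymx_unit // mul1mx mulmxK ?unitarymx_unit //.
    by rewrite mxE eqxx.
  have := Apos (fun i => P l i); congr (_ <= _).
  rewrite (invmx_unitary Pu) mxE exchange_big; apply: eq_bigr => j _.
  rewrite mxE mulr_suml; apply: eq_bigr => i _.
  by rewrite !mxE mulrAC.
exists (\matrix_(i, l) ((P l i)^* * sqrtC (d 0 l))) => i j.
rewrite AE'; apply: eq_bigr => l _.
have sr : (sqrtC (d 0 l))^* = sqrtC (d 0 l).
  by apply/CrealP/ger0_real; rewrite sqrtC_ge0.
rewrite !mxE rmorphM /= conjCK sr -[d 0 l in LHS]sqrtCK; ring.
Qed.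

(* the Schur product theorem *)
Lemma psd_mul (X Y : choiceType) (k1 : X -> X -> C) (k2 : Y -> Y -> C) :
  psd_kernel k1 -> psd_kernel k2 ->
  psd_kernel (fun p q : X * Y => k1 p.1 q.1 * k2 p.2 q.2).
Proof.
move=> [s1 p1] [s2 p2]; split=> [x y|u]; first by rewrite rmorphM s1 s2.
case: u => [|p0 u0]; first by rewrite gramE big_nil.
set u := p0 :: u0; pose n := size u.
pose x (i : 'I_n) := nth p0 u i.
pose A := \matrix_(i < n, j < n) k1 (x i).2.1 (x j).2.1.
have [|c|B hB] := @psd_matrix n A; first by move=> i j; rewrite !mxE.
  have := p1 [seq (c i, (x i).2.1) | i <- index_enum 'I_n].
  rewrite gramE big_map /=.
  congr (_ <= _); apply: eq_bigr => i _; rewrite big_map /=.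
  by apply: eq_bigr => j _; rewrite mxE.
have -> : gram (fun p q : X * Y => k1 p.1 q.1 * k2 p.2 q.2) u u =
  \sum_l gram k2 [seq ((x i).1 * B i l, (x i).2.2) | i <- index_enum 'I_n]
                 [seq ((x i).1 * B i l, (x i).2.2) | i <- index_enum 'I_n].
  rewrite gramE (big_nth p0) big_mkord.
  under [RHS]eq_bigr do rewrite gramE big_map.
  rewrite [RHS]exchange_big /=; apply: eq_bigr => i _.
  under [RHS]eq_bigr do rewrite big_map.
  rewrite [RHS]exchange_big (big_nth p0) big_mkord /=; apply: eq_bigr => j _.
  have := hB i j; rewrite mxE -/(x i) -/(x j) => ->.
  rewrite mulr_suml mulr_sumr; apply: eq_bigr => l _.
  by rewrite rmorphM /=; ring.
by apply: sumr_ge0.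
Qed.

End PsdKernels.

Notation realHilbertType R := (hilbertType (@idfun R)).
Notation complexHilbertType R := (hilbertType (@Num.conj R[i])).

Definition complexification (R : realType) (H : realHilbertType R) : Type :=
  (H * H)%type.

Section Complexification.
Variables (R : realType) (H : realHilbertType R).
Local Notation C := R[i].
Local Notation HC := (complexification H).

HB.instance Definition _ := GRing.Zmodule.copy HC (H * H)%type.

Definition complexification_scale (a : C) (x : HC) : HC :=
  (complex.Re a *: x.1 - complex.Im a *: x.2,
   complex.Re a *: x.2 + complex.Im a *: x.1).

Let scaleA a b x : complexification_scale a (complexification_scale b x) =
  complexification_scale (a * b) x.
Proof.
case: a b => [a1 a2] [b1 b2]; rewrite /complexification_scale /=.
congr (_, _); rewrite !(scalerDr, scalerN, scalerBl, scalerDl) !scalerA.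
  by rewrite !opprD [RHS]addrACA; congr (_ + _); rewrite addrC.
by rewrite [RHS]addrACA; congr (_ + _); rewrite addrC.
Qed.

Let scale1 : left_id 1 complexification_scale.
Proof.
by move=> [x y]; rewrite /complexification_scale /= !scale1r !scale0r subr0 addr0.
Qed.

Let scaleDr : right_distributive complexification_scale +%R.
Proof.
move=> a x y; rewrite /complexification_scale /=.
by congr (_, _); rewrite !scalerDr ?opprD addrACA.
Qed.

Let scaleDl x : {morph complexification_scale^~ x : a b / a + b}.
Proof.
move=> [a1 a2] [b1 b2]; rewrite /complexification_scale /=.
by congr (_, _); rewrite !scalerDl ?opprD addrACA.
Qed.

HB.instance Definition _ := GRing.Zmodule_isLmodule.Build C HC
  scaleA scale1 scaleDr scaleDl.

Definition complexify (xi : H) : HC := (xi, 0).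

Definition complexification_inner (x y : HC) : C :=
  Complex (inner x.1 y.1 + inner x.2 y.2) (inner x.2 y.1 - inner x.1 y.2).

Lemma complexification_inner_psd : psd_kernel complexification_inner.
Proof.
apply: psd_form => [z a x y|x y|x].
- rewrite /complexification_inner; case: a => a1 a2.
  have iD (u v w : H) : inner (u + v) w = inner u w + inner v w.
    by have := inner_linear w 1 u v; rewrite scale1r mul1r.
  have i0 (w : H) : inner 0 w = 0.
    by have := inner_linear w (-1) 0 0; rewrite scaler0 addr0 mulN1r addNr.
  have iZ a (u w : H) : inner (a *: u) w = a * inner u w.
    by have := inner_linear w a u 0; rewrite !addr0 i0 addr0.
  rewrite /= !(iD, iZ) -!scaleNr !iZ.
  apply/eqP; rewrite eq_complex /=; apply/andP; split; apply/eqP; ring.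
- have conjE (a b : R) : (Complex a b)^* = Complex a (- b) by [].
  rewrite conjE opprB /complexification_inner [inner y.1 x.1]inner_sym.
  rewrite [inner y.2 x.2]inner_sym [inner y.2 x.1]inner_sym.
  by rewrite [inner y.1 x.2]inner_sym.
- rewrite /complexification_inner [inner x.2 x.1]inner_sym subrr.
  rewrite lecE /= eqxx /= !inner_norm addr_ge0 // exprn_ge0 //.
Qed.

End Complexification.

Section Fock.
Variables (R : realType) (H : realHilbertType R).
Local Notation C := R[i].
Local Notation HC := (complexification H).

(* The word [:: x_1; ...; x_n] stands for x_1 (x) ... (x) x_n, and [::] for the
   vacuum: words of different lengths are orthogonal, and on words of length n
   this is the inner product of H_C^(x)n.  The Hilbert space of this kernel is
   therefore the Hilbert direct sum of C and of the Hilbert tensor powers. *)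
Fixpoint tensor_inner (v w : seq HC) : C :=
  match v, w with
  | [::], [::] => 1
  | x :: v', y :: w' => complexification_inner x y * tensor_inner v' w'
  | _, _ => 0
  end.

Lemma tensor_inner_psd : psd_kernel tensor_inner.
Proof.
pose g (v : seq HC) := if v is x :: v' then Some (x, v') else None.
pose nil_kernel := opt_kernel (fun v : seq HC => if nilp v then Some tt else None)
  (fun _ _ => 1 : C).
pose K := fix K n (v w : seq HC) : C :=
  if n is n'.+1 then nil_kernel v w + opt_kernel g
    (fun p q => complexification_inner p.1 q.1 * K n' p.2 q.2) v w
  else 0.
have Kpsd n : psd_kernel (K n).
  elim: n => [|n IH].
    split=> [v w|u]; first by rewrite conjC0.
    by rewrite gramE big1 // => p _; rewrite big1 // => q _; rewrite mulr0.
  apply: psd_add; apply: psd_opt.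
    apply: (@psd_delta R unit).
  apply: psd_mul => //; exact: complexification_inner_psd.
have KE n v w : (size v < n)%N -> K n v w = tensor_inner v w.
  elim: n v w => [//|n IH] [|x v] [|y w] //= sv;
   rewrite /nil_kernel /opt_kernel /= ?addr0 ?add0r //.
  by rewrite IH.
split=> [v w|u].
  have := (Kpsd (maxn (size v) (size w)).+1).1 v w.
  by rewrite !KE // ltnS ?leq_maxl ?leq_maxr.
pose n := (\max_(p <- u) size p.2).+1.
suff -> : gram tensor_inner u u = gram (K n) u u by exact: (Kpsd n).2.
rewrite !gramE big_seq [RHS]big_seq; apply: eq_bigr => p pu.
apply: eq_bigr => q _; rewrite KE // ltnS.
by rewrite (big_rem p) //= leq_maxl.
Qed.

Definition fock_space := kernel_space (PsdKernel tensor_inner_psd).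
HB.instance Definition _ := Hilbert.on fock_space.
End Fock.

Section Ltwo.
Variables (R : realType) (F : complexHilbertType R).

(* l^2(Z, F): the pair (n, x) stands for the sequence with value x at n and 0
   elsewhere. *)
Definition ltwo_inner (p q : int * F) : R[i] :=
  (p.1 == q.1)%:R * inner p.2 q.2.

Lemma ltwo_inner_psd : psd_kernel ltwo_inner.
Proof.
have := @psd_mul R int F (fun m n => (m == n)%:R) inner; apply.
  exact: psd_delta.
apply: psd_form => [z a x y|x y|x].
- exact: inner_linear.
- exact: inner_sym.
- by rewrite inner_norm exprn_ge0.
Qed.

Definition ltwo_space := kernel_space (PsdKernel ltwo_inner_psd).
HB.instance Definition _ := Hilbert.on ltwo_space.
End Ltwo.

Section Operators.
Variables (R : realType) (V : complexHilbertType R).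
Implicit Types (T : V -> V) (S M : set (V -> V)).

Definition bounded_operator T := linear T /\ continuous T.

(* Definite description: an everywhere defined bounded operator has exactly one
   bounded adjoint. *)
Definition adjoint T : V -> V :=
  get [set T' | bounded_operator T' /\
                forall x y, inner (T x) y = inner x (T' y)].

Definition commutant S : set (V -> V) :=
  [set T | bounded_operator T /\ forall A, S A -> T \o A = A \o T].

(* By von Neumann's bicommutant theorem this is the smallest von Neumann
   algebra containing S. *)
Definition generated_vN S : set (V -> V) :=
  commutant (commutant (S `|` [set adjoint A | A in S])).

Definition is_factor M : Prop :=
  M `&` commutant M = [set T | exists c : R[i], T = (fun x => c *: x)].

End Operators.

Section FreeGaussian.
Variables (R : realType) (H : realHilbertType R).
Local Notation F := (fock_space H).

Definition tensor (w : seq (complexification H)) : F := kernel_vec _ w.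

Lemma tensorE v w : inner (tensor v) (tensor w) = tensor_inner v w.
Proof. exact: kernel_vecE. Qed.

Definition vacuum : F := tensor [::].

(* Definite description: elementary tensors are total. *)
Definition creation (xi : H) : F -> F :=
  get [set L | bounded_operator L /\
               forall w, L (tensor w) = tensor (complexify xi :: w)].

Definition semicircular (xi : H) : F -> F :=
  creation xi + adjoint (creation xi).

Definition free_gaussian_vN : set (F -> F) :=
  generated_vN [set semicircular xi | xi in [set: H]].

Definition vacuum_state (x : F -> F) : R[i] := inner (x vacuum) vacuum.

(* An action by trace preserving *-automorphisms, with sigma n only relevant on
   the algebra; bijectivity of sigma n follows from the group law. *)
Record trace_preserving_action (sigma : int -> (F -> F) -> (F -> F)) : Prop := {
  action_stable n x : free_gaussian_vN x -> free_gaussian_vN (sigma n x);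
  action_linear n a x y : free_gaussian_vN x -> free_gaussian_vN y ->
    sigma n (a *: x + y) = a *: sigma n x + sigma n y;
  action_mul n x y : free_gaussian_vN x -> free_gaussian_vN y ->
    sigma n (x \o y) = sigma n x \o sigma n y;
  action_adjoint n x : free_gaussian_vN x ->
    sigma n (adjoint x) = adjoint (sigma n x);
  action0 x : free_gaussian_vN x -> sigma 0 x = x;
  actionD m n x : free_gaussian_vN x ->
    sigma (m + n) x = sigma m (sigma n x);
  action_trace n x : free_gaussian_vN x ->
    vacuum_state (sigma n x) = vacuum_state x }.

(* Definite description: trace preservation makes each sigma n determined by its
   values on the generators. *)
Definition free_gaussian_action (pi : int -> H -> H) :
    int -> (F -> F) -> (F -> F) :=
  get [set sigma | trace_preserving_action sigma /\
    forall n xi, sigma n (semicircular xi) = semicircular (pi n xi)].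

End FreeGaussian.

Section CrossedProduct.
Variables (R : realType) (F : complexHilbertType R).
Local Notation L2 := (ltwo_space F).

Definition delta (n : int) (x : F) : L2 := kernel_vec _ (n, x).

Lemma deltaE m n x y : inner (delta m x) (delta n y) = (m == n)%:R * inner x y.
Proof. exact: kernel_vecE. Qed.

(* x acts on the n-th coordinate by sigma (- n) x, and crossed_shift implements
   sigma on the image of this representation. *)
Definition crossed_embedding (sigma : int -> (F -> F) -> (F -> F))
    (x : F -> F) : L2 -> L2 :=
  get [set T | bounded_operator T /\
               forall n v, T (delta n v) = delta n (sigma (- n) x v)].

Definition crossed_shift (m : int) : L2 -> L2 :=
  get [set T | bounded_operator T /\
               forall n v, T (delta n v) = delta (m + n) v].

Definition crossed_product (M : set (F -> F))
    (sigma : int -> (F -> F) -> (F -> F)) : set (L2 -> L2) :=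
  generated_vN ([set crossed_embedding sigma x | x in M] `|`
                [set crossed_shift m | m in [set: int]]).

End CrossedProduct.

Section Representation.
Variables (R : realType) (H : realHilbertType R) (pi : int -> H -> H).

Record orthogonal_representation : Prop := {
  representation_linear n : linear (pi n);
  representation_isometry n x y : inner (pi n x) (pi n y) = inner x y;
  representation0 : pi 0 = id;
  representationD m n : pi (m + n) = pi m \o pi n }.

Definition faithful_representation := forall n, n != 0 -> pi n <> id.

Definition free_gaussian_crossed_product :
    set (ltwo_space (fock_space H) -> ltwo_space (fock_space H)) :=
  crossed_product (@free_gaussian_vN R H) (free_gaussian_action pi).

End Representation.

(* Main.v *)
(* Write lambda_n for the unitary implementing n, Omega for the vacuum.  If
   pi n = id with n <> 0, then lambda_n is a central nonscalar element.

   Conversely let T be central and zeta_n the n-th coefficient of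
   T (delta_0 Omega).  Since s(eta) Omega = r(eta) Omega, where r(eta) is the right
   semicircular operator, which commutes with Gamma(H)'', the vector zeta = zeta_n
   satisfies s(alpha eta) zeta = r(eta) zeta for all eta, with alpha = pi (- n).
   For a unit vector e with image f = alpha e, the numbers
   k i j = <f^i (x) w (x) e^j, zeta>, where w starts orthogonally to f and ends
   orthogonally to e, then solve the discrete wave equation
   k (i+1) j + k (i-1) j = k i (j+1) + k i (j-1) with zero boundary values, and
   they decay because words of different lengths are orthogonal; this forces k = 0.
   The numbers <f^i (x) e^j, zeta> solve the same equation with boundary values
   k (-1) j = c * k 0 (j-1), k i (-1) = c * k (i-1) 0 for c = <e, f>, and vanish as
   soon as c <> 1.  Hence zeta = 0 if alpha <> id.  If alpha = id, a second vector
   orthogonal to e, which exists when pi is faithful, kills the coefficients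
   <e^n, zeta>, n > 0, and zeta is a multiple of Omega.  So T (delta_0 Omega) is a
   multiple of delta_0 Omega, which is separating, and T is a scalar. *)
From HB Require Import structures.
Require Import Defs.
From mathcomp Require Import all_boot all_order all_algebra.
From mathcomp Require Import complex ring.
From mathcomp Require Import boolp classical_sets functions reals topology normedtype sequences.
Set Implicit Arguments.
Unset Strict Implicit.
Unset Printing Implicit Defensive.
Import Order.TTheory GRing.Theory Num.Theory.
Import numFieldNormedType.Exports.
Local Open Scope classical_set_scope.
Local Open Scope ring_scope.

(** * Hilbert space operators *)

Section Harmonic.
Variable R : realType.
Local Notation C := R[i].

(** Limits are taken along the explicit null sequence 1/(n+1), so that the later approximation
    arguments are plain estimates with a rate. *)
Lemma harmonic_le (a b K : C) :
  (forall n : nat, a <= b + K * n.+1%:R^-1) -> a <= b.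
Proof.
move=> h; apply: (@lim_leC R (fun=> a) _ a b h); first exact: cvgC_cst.
apply: cvgC_lim (cvgCD (cvgC_cst b) (cvgCM (cvgC_cst K) (@cvgC_harmonic R))) _.
by rewrite mulr0 addr0.
Qed.

Lemma harmonic_eq0 (a K : C) : (forall n : nat, `|a| <= K * n.+1%:R^-1) -> a = 0.
Proof.
move=> h; apply/eqP; rewrite -normr_le0.
by apply: (@harmonic_le _ _ K) => n; rewrite add0r.
Qed.

(** Letting [m] tend to infinity in the Cauchy estimate gives the rate for the limit. *)
Lemma harmonic_cauchy (V : completeNormedModType C) (u : nat -> V) (K : C) :
  0 <= K ->
  (forall n m, `|u n - u m| <= K * (n.+1%:R^-1 + m.+1%:R^-1)) ->
  exists x, forall n, `|u n - x| <= K * n.+1%:R^-1.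
Proof.
move=> K0 h.
have cu : cvg (u @ \oo).
  apply/cauchy_cvgP/cauchy_ballP => e e0.
  have d0 : 0 < e / (K + 1) / 2 by rewrite !divr_gt0 // ltr_wpDl.
  have := @cvgC_harmonic R => /cvgrPdist_lt/(_ _ d0) He.
  pose A := [set x | exists2 n : nat, n.+1%:R^-1 < e / (K + 1) / 2 & x = u n].
  exists (A, A) => /=.
    suff FA : \forall n \near \oo, A (u n) by [].
    near=> n; exists n => //.
    have : `|0 - n.+1%:R^-1 : C| < e / (K + 1) / 2 by near: n.
    by rewrite sub0r normrN ger0_norm ?invr_ge0.
  move=> [_ _] /= [[n hn ->] [m hm ->]]; rewrite -ball_normE /=.
  apply: (le_lt_trans (h n m)).
  apply: (@le_lt_trans _ _ ((K + 1) * (n.+1%:R^-1 + m.+1%:R^-1))).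
    by rewrite ler_wpM2r ?addr_ge0 ?invr_ge0 ?lerDl.
  by rewrite -ltr_pdivlMl ?ltr_wpDl // mulrC [ltRHS]splitr ltrD.
exists (lim (u @ \oo)) => n.
have c1 : `|u n - u m| @[m --> \oo] --> `|u n - lim (u @ \oo)|.
  by apply: cvg_norm; apply: cvgB => //; exact: cvg_cst.
apply: (@lim_leC R _ (fun m => K * (n.+1%:R^-1 + m.+1%:R^-1)) _ _ (h n) c1).
apply: cvgC_lim
  (cvgCM (cvgC_cst K) (cvgCD (cvgC_cst n.+1%:R^-1) (@cvgC_harmonic R))) _.
by rewrite addr0.
Unshelve. all: by end_near. Qed.

End Harmonic.

Section Inner.
Variables (R : realType) (V : complexHilbertType R).
Local Notation C := R[i].
Implicit Types (x y z : V) (a : C).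

Lemma innerC x y : (inner x y)^* = inner y x.
Proof. by rewrite -inner_sym. Qed.

Lemma innerDl z x y : inner (x + y) z = inner x z + inner y z.
Proof. by have := inner_linear z 1 x y; rewrite scale1r mul1r. Qed.

Lemma inner0l z : inner 0 z = 0 :> C.
Proof. by apply: (addrI (inner 0 z)); rewrite -innerDl !addr0. Qed.

Lemma innerZl z a x : inner (a *: x) z = a * inner x z.
Proof. by have := inner_linear z a x 0; rewrite addr0 inner0l addr0. Qed.

Lemma innerNl z x : inner (- x) z = - inner x z.
Proof. by rewrite -scaleN1r innerZl mulN1r. Qed.

Lemma inner_suml z (I : Type) (r : seq I) (F : I -> V) :
  inner (\sum_(i <- r) F i) z = \sum_(i <- r) inner (F i) z.
Proof.
by elim: r => [|i r IH]; rewrite ?big_nil ?inner0l // !big_cons innerDl IH.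
Qed.

Lemma innerDr z x y : inner z (x + y) = inner z x + inner z y.
Proof. by rewrite inner_sym innerDl rmorphD /= !innerC. Qed.

Lemma inner0r z : inner z 0 = 0 :> C.
Proof. by rewrite inner_sym inner0l rmorph0. Qed.

Lemma innerZr z a x : inner z (a *: x) = a^* * inner z x.
Proof. by rewrite inner_sym innerZl rmorphM /= innerC. Qed.

Lemma innerNr z x : inner z (- x) = - inner z x.
Proof. by rewrite inner_sym innerNl rmorphN /= innerC. Qed.

Lemma innerBr z x y : inner z (x - y) = inner z x - inner z y.
Proof. by rewrite innerDr innerNr. Qed.

Lemma inner_sumr z (I : Type) (r : seq I) (F : I -> V) :
  inner z (\sum_(i <- r) F i) = \sum_(i <- r) inner z (F i).
Proof.
by elim: r => [|i r IH]; rewrite ?big_nil ?inner0r // !big_cons innerDr IH.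
Qed.

Lemma inner_eq0 x : inner x x = 0 -> x = 0.
Proof.
by rewrite inner_norm => /eqP; rewrite expf_eq0 normr_eq0 => /andP[_ /eqP].
Qed.

Lemma inner_ext x y : (forall z, inner z x = inner z y) -> x = y.
Proof.
move=> h; apply/eqP; rewrite -subr_eq0; apply/eqP/inner_eq0.
by rewrite innerBr h subrr.
Qed.

Lemma inner_CS x y : `|inner x y| <= `|x| * `|y|.
Proof.
(* The inner product is viewed as a positive semidefinite kernel on [V]; one-term combinations turn
   [gram_CS2] into the claim. *)
have ipsd : psd_kernel (inner : V -> V -> C).
  apply: psd_form => [z a u v|u v|u]; first exact: inner_linear.
    exact: inner_sym.
  by rewrite inner_norm exprn_ge0.
have gE u v : gram inner [:: (1, u)] [:: (1, v)] = inner u v :> C.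
  by rewrite gramE !big_seq1 rmorph1 !mul1r.
have := gram_CS2 ipsd [:: (1, x)] [:: (1, y)].
by rewrite !gE !inner_norm -exprMn ler_pXn2r ?nnegrE ?mulr_ge0.
Qed.

End Inner.

Section LinearMaps.
Variables (K : pzRingType) (V W : lmodType K) (T : V -> W).
Hypothesis lT : linear T.

Let g : {linear V -> W} := HB.pack T (GRing.isLinear.Build _ _ _ _ T lT).

Lemma lin0 : T 0 = 0. Proof. exact: (linear0 g). Qed.
Lemma linD : {morph T : x y / x + y}. Proof. exact: (linearD g). Qed.
Lemma linZ a : {morph T : x / a *: x}. Proof. exact: (linearZ_LR g). Qed.
Lemma lin_sum (I : Type) (r : seq I) (E : I -> V) :
  T (\sum_(i <- r) E i) = \sum_(i <- r) T (E i).
Proof. exact: (linear_sum g). Qed.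

End LinearMaps.

Section BoundedLinearMaps.
Variables (R : realType) (V W : complexHilbertType R) (T : V -> W).
Hypothesis lT : linear T.

Let g : {linear V -> W} := HB.pack T (GRing.isLinear.Build _ _ _ _ T lT).

Lemma linear_continuous_bounded : continuous T ->
  exists2 M, 0 <= M & forall x, `|T x| <= M * `|x|.
Proof.
move=> cT; have /linear_boundedP : bounded_near g (nbhs 0).
  by apply/linear_bounded_continuous.
by move=> /pinfty_ex_gt0[M M0 h]; exists M; first exact: ltW.
Qed.

Lemma linear_bound_continuous M :
  (forall x, `|T x| <= M * `|x|) -> continuous T.
Proof.
move=> h; apply/(linear_bounded_continuous g)/linear_boundedP.
exists `|M|; split; first exact: normr_real.
move=> r /ltW Mr x; apply: le_trans (h x) _.
have [->|x0] := eqVneq x 0; first by rewrite normr0 !mulr0.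
have x1 : 0 < `|x| by rewrite normr_gt0.
rewrite ler_pM2r //; apply: le_trans Mr.
apply: real_ler_norm.
have := le_trans (normr_ge0 _) (h x).
by rewrite pmulr_lge0 // => /ger0_real.
Qed.

End BoundedLinearMaps.

(** * The Riesz representation theorem and adjoints *)

Section Riesz.
Variables (R : realType) (V : complexHilbertType R) (phi : V -> R[i]).
Local Notation C := R[i].
Hypothesis phi_lin : forall a x y, phi (a *: x + y) = a * phi x + phi y.
Variable M : C.
Hypothesis M0 : 0 <= M.
Hypothesis phi_bd : forall x, `|phi x| <= M * `|x|.

Let phiD x y : phi (x + y) = phi x + phi y.
Proof. by have := phi_lin 1 x y; rewrite scale1r mul1r. Qed.
Let phi0 : phi 0 = 0.
Proof. by apply: (addrI (phi 0)); rewrite -phiD !addr0. Qed.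
Let phiZ a x : phi (a *: x) = a * phi x.
Proof. by have := phi_lin a x 0; rewrite addr0 phi0 addr0. Qed.


(* The minimizer of J represents phi: minimizing sequences are Cauchy by the
   parallelogram law. *)
Let J x : C := `|x| ^+ 2 - (phi x + (phi x)^*).

(** The linear part of [J] is at most 2M|x|, so J x + M^2 dominates (|x| - M)^2. *)
Let J_lower x : - M ^+ 2 <= J x.
Proof.
have h : phi x + (phi x)^* <= 2 * (M * `|x|).
  rewrite mulr_natl mulr2n; apply: le_trans (_ : `|phi x| + `|(phi x)^*| <= _).
    apply: le_trans (ler_normD _ _); apply: real_ler_norm.
    by rewrite CrealE rmorphD /= conjCK addrC.
  by rewrite norm_conjC lerD.
have sq : 0 <= (`|x| - M) ^+ 2.
  by rewrite real_exprn_even_ge0 // realB // ger0_real.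
rewrite -subr_ge0 in h; rewrite -subr_ge0; have := addr_ge0 sq h.
by congr (_ <= _); rewrite /J; ring.
Qed.

(** The order of the complex numbers is partial, but a function bounded below by a real number takes
    real values; its infimum is that of the real parts. *)
Let Cinf (f : V -> C) L : L \is Num.real -> (forall x, L <= f x) ->
  exists m, (forall x, m <= f x) /\ forall e, 0 < e -> exists x, f x < m + e.
Proof.
move=> Lr Lf; pose E := range (fun x => complex.Re (f x)).
have fr x : f x = (complex.Re (f x))%:C%C.
  by rewrite RRe_real //; have := ler_real (Lf x); rewrite Lr.
have hE : has_inf E.
  split; first by exists (complex.Re (f 0)), 0.
  exists (complex.Re L) => _ [x _ <-]; rewrite -lecR RRe_real // -fr; exact: Lf.
exists (inf E)%:C%C; split=> [x|e e0].
  by rewrite fr lecR; apply: (ge_inf hE.2); exists x.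
have er : e = (complex.Re e)%:C%C by rewrite RRe_real // gtr0_real.
have e0' : 0 < complex.Re e by rewrite -ltcR -er.
have [_ [x _ <-] hx] := inf_adherent e0' hE.
by exists x; rewrite fr er -raddfD ltcR.
Qed.

Lemma riesz : exists y, forall x, phi x = inner x y.
Proof.
have [m [m_le m_adh]] : exists m, (forall x, m <= J x) /\
    forall e, 0 < e -> exists x, J x < m + e.
  by apply: Cinf J_lower; rewrite rpredN ger0_real // exprn_ge0.
(* The tolerance is squared because [J] controls squared distances; the distances then decay like
   1/(n+1). *)
have eps_gt0 n : 0 < n.+1%:R^-1 ^+ 2 :> C by rewrite exprn_gt0 // invr_gt0.
pose x n := projT1 (cid (m_adh _ (eps_gt0 n))).
have xP n : J (x n) < m + n.+1%:R^-1 ^+ 2 := projT2 (cid (m_adh _ (eps_gt0 n))).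
have normE (u : V) : `|u| ^+ 2 = inner u u :> C by rewrite inner_norm.
(* The parallelogram law, in which the linear terms of [J] cancel. *)
have par u v : J u + J v = 2 * J (2^-1 *: (u + v)) + 2^-1 * `|u - v| ^+ 2.
  rewrite /J !normE !(innerZl, innerZr, innerDl, innerDr, innerNl, innerNr).
  rewrite !phiZ phiD !(rmorphM, rmorphD) /= !fmorphV /= !conjC_nat.
  by field.
have [y hy] : exists y, forall n, `|x n - y| <= 2 * n.+1%:R^-1.
  apply: harmonic_cauchy => // n k.
  rewrite -(@ler_pXn2r _ 2) ?nnegrE ?mulr_ge0 ?addr_ge0 ?invr_ge0 //.
  have := ltW (ltrD (xP n) (xP k)); rewrite par.
  have := m_le (2^-1 *: (x n + x k)).
  move: (J _) => j mj h.
  have {h} : 2^-1 * `|x n - x k| ^+ 2 <= n.+1%:R^-1 ^+ 2 + k.+1%:R^-1 ^+ 2.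
    rewrite -subr_ge0 in mj; rewrite -subr_ge0 in h; rewrite -subr_ge0.
    have := addr_ge0 (mulr_ge0 (ler0n C 2) mj) h; congr (_ <= _); ring.
  rewrite ler_pdivrMl // => /le_trans; apply.
  rewrite exprMn sqrrD -subr_ge0.
  set a := n.+1%:R^-1; set b := k.+1%:R^-1.
  have a0 : 0 <= a :> C by rewrite invr_ge0.
  have b0 : 0 <= b :> C by rewrite invr_ge0.
  have : 0 <= 2 * (a ^+ 2 + b ^+ 2) + 8 * (a * b).
    by rewrite addr_ge0 // mulr_ge0 // ?addr_ge0 ?exprn_ge0 // mulr_ge0.
  by congr (_ <= _); ring.
exists y => z; apply/eqP; rewrite -subr_eq0; apply/eqP.
(* The summand 1 keeps [B] invertible when [z] is zero. *)
pose B : C := `|z| ^+ 2 + 1.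
have B1 : 0 < B by rewrite ltr_wpDl // exprn_ge0.
apply: (@harmonic_eq0 _ _ (B + `|z| * 2)) => n.
pose d := inner z (x n) - phi z.
have -> : phi z - inner z y = inner z (x n - y) - d by rewrite innerBr /d; ring.
apply: le_trans (ler_normB _ _) _; rewrite addrC mulrDl lerD //; last first.
  by apply: le_trans (inner_CS _ _) _; rewrite -mulrA ler_wpM2l.
have n1 : 0 <= n.+1%:R^-1 :> C by rewrite invr_ge0.
rewrite -(@ler_pXn2r _ 2) ?nnegrE ?mulr_ge0 ?(ltW B1) // exprMn normCK.
have Br : (B^-1)^* = B^-1 by apply/CrealP/gtr0_real; rewrite invr_gt0.
have zz : inner z z = B - 1 :> C by rewrite -normE /B addrK.
(* Variation in the direction of [z]: this move changes [J] by -|d|^2 (B + 1) / B^2. As [x n] is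
   minimal up to 1/(n+1)^2, the defect |d| is at most B/(n+1). *)
have JE : J (x n + (- (B^-1 * d^*)) *: z) =
    J (x n) - 2 * B^-1 * (d * d^*) + B^-1 ^+ 2 * (d * d^*) * (B - 1).
  have dE : inner (x n) z = d^* + (phi z)^* by rewrite /d rmorphB /= innerC subrK.
  have dE' : inner z (x n) = d + phi z by rewrite /d subrK.
  move: d dE dE' => d dE dE'.
  rewrite /J !normE !(innerZl, innerZr, innerDl, innerDr) phiD phiZ zz.
  rewrite !(rmorphM, rmorphD, rmorphN) /= conjCK Br dE dE'; ring.
have := m_le (x n + (- (B^-1 * d^*)) *: z).
rewrite JE => h1; have h2 := ltW (xP n).
have d0 : 0 <= d * d^* by rewrite -normCK exprn_ge0.
have h3 : d * d^* * (B + 1) <= B ^+ 2 * n.+1%:R^-1 ^+ 2.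
  rewrite -subr_ge0 in h1; rewrite -subr_ge0 in h2; rewrite -subr_ge0.
  have := mulr_ge0 (exprn_ge0 2 (ltW B1)) (addr_ge0 h1 h2); congr (_ <= _).
  by move: (B) (lt0r_neq0 B1) (n.+1%:R^-1) (J (x n)) => b b0 r j; field.
apply: le_trans h3.
by rewrite ler_peMr // lerDr ltW.
Qed.

End Riesz.

Section Adjoint.
Variables (R : realType) (V W : complexHilbertType R).
Local Notation C := R[i].

(** The Riesz theorem for x |-> <T x, y> gives [T'] pointwise, and |T' y|^2 = <T (T' y), y> bounds
    it. Two spaces are allowed so that the coordinate embeddings [delta n] are covered. *)
Lemma adjoint_pair_exists (T : V -> W) : linear T -> continuous T ->
  exists T' : W -> V, [/\ linear T', continuous T' &
    forall x y, inner (T x) y = inner x (T' y)].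
Proof.
move=> lT cT; have [M M0 hM] := linear_continuous_bounded lT cT.
have ex y : exists z, forall x, inner (T x) y = inner x z.
  apply: (@riesz _ _ (fun x => inner (T x) y) _ (M * `|y|)).
  - by move=> a u v; rewrite lT inner_linear.
  - exact: mulr_ge0.
  - move=> x; apply: le_trans (inner_CS _ _) _; rewrite mulrAC.
    exact: ler_wpM2r.
pose T' y := projT1 (cid (ex y)).
have T'P x y : inner (T x) y = inner x (T' y) by exact: projT2 (cid (ex y)) x.
have lT' : linear T'.
  move=> a u v; apply: inner_ext => z.
  by rewrite -T'P !(innerDr, innerZr) !T'P.
exists T'; split=> //; apply: (linear_bound_continuous lT' (M := M)) => y.
have [->|n0] := eqVneq (T' y) 0; first by rewrite normr0 mulr_ge0.
have n1 : 0 < `|T' y| by rewrite normr_gt0.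
rewrite -(ler_pM2r n1) -expr2 -inner_norm -T'P.
have := inner_CS (T (T' y)) y; rewrite ger0_norm; last first.
  by rewrite T'P inner_norm exprn_ge0.
by move/le_trans; apply; rewrite [leRHS]mulrAC ler_wpM2r //; exact: hM.
Qed.

End Adjoint.

Section BoundedOperators.
Variables (R : realType) (V : complexHilbertType R).
Local Notation C := R[i].
Implicit Types (S T A : V -> V).

Lemma adjointP T : bounded_operator T ->
  bounded_operator (adjoint T) /\ forall x y, inner (T x) y = inner x (adjoint T y).
Proof.
move=> [lT cT]; have [T' [? ? hT']] := adjoint_pair_exists lT cT.
have h : [set T' | bounded_operator T' /\
    forall x y, inner (T x) y = inner x (T' y)] T' by [].
exact: (@getPex _ _ (ex_intro _ T' h)).
Qed.

Lemma bounded_adjoint T : bounded_operator T -> bounded_operator (adjoint T).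
Proof. by case/adjointP. Qed.

Lemma inner_adjointr T x y : bounded_operator T ->
  inner x (adjoint T y) = inner (T x) y.
Proof. by case/adjointP => _ ->. Qed.

Lemma inner_adjointl T x y : bounded_operator T ->
  inner (adjoint T x) y = inner x (T y).
Proof. by move=> bT; rewrite inner_sym inner_adjointr // innerC. Qed.

Lemma adjoint_unique T T' : bounded_operator T ->
  (forall x y, inner (T x) y = inner x (T' y)) -> adjoint T = T'.
Proof.
move=> bT h; apply/funext => y; apply: inner_ext => x.
by rewrite inner_adjointr.
Qed.

Lemma adjointK T : bounded_operator T -> adjoint (adjoint T) = T.
Proof.
move=> bT; apply: adjoint_unique; first exact: bounded_adjoint.
by move=> x y; rewrite inner_adjointl.
Qed.

Lemma inner_selfadjoint T x y : bounded_operator T -> adjoint T = T ->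
  inner (T x) y = inner x (T y).
Proof. by move=> bT sT; rewrite -{1}sT inner_adjointl. Qed.

Lemma bounded_comp S T : bounded_operator S -> bounded_operator T ->
  bounded_operator (S \o T).
Proof.
move=> [lS cS] [lT cT]; split=> [a x y /=|x]; first by rewrite lT lS.
by apply: continuous_comp; [exact: cT | exact: cS].
Qed.

Lemma bounded_add S T : bounded_operator S -> bounded_operator T ->
  bounded_operator (S + T).
Proof.
move=> [lS cS] [lT cT]; split=> [a x y|x]; last exact: (cvgD (cS x) (cT x)).
by rewrite !fctE lS lT scalerDr addrACA.
Qed.

Lemma bounded_scale (c : C) T : bounded_operator T -> bounded_operator (c *: T).
Proof.
move=> [lT cT]; have lcT : linear (c *: T).
  by move=> a x y; rewrite !fctE lT scalerDr !scalerA mulrC.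
split=> //; have [M M0 hM] := linear_continuous_bounded lT cT.
apply: (linear_bound_continuous lcT (M := `|c| * M)) => x.
by rewrite fctE normrZ -mulrA ler_wpM2l.
Qed.

Lemma bounded_id : bounded_operator (@id V).
Proof. by split=> [a x y|x] //; exact: cvg_id. Qed.

Lemma adjoint_comp S T : bounded_operator S -> bounded_operator T ->
  adjoint (S \o T) = adjoint T \o adjoint S.
Proof.
move=> bS bT; apply: adjoint_unique; first exact: bounded_comp.
by move=> x y /=; rewrite !inner_adjointr.
Qed.

Lemma adjoint_add S T : bounded_operator S -> bounded_operator T ->
  adjoint (S + T) = adjoint S + adjoint T.
Proof.
move=> bS bT; apply: adjoint_unique; first exact: bounded_add.
by move=> x y; rewrite !fctE innerDl innerDr !inner_adjointr.
Qed.

Lemma comm_adjoint S T : bounded_operator S -> bounded_operator T ->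
  S \o T = T \o S -> adjoint S \o adjoint T = adjoint T \o adjoint S.
Proof. by move=> bS bT c; rewrite -!adjoint_comp // c. Qed.

End BoundedOperators.

(** * Commutants and generated von Neumann algebras *)

Section VonNeumann.
Variables (R : realType) (V : complexHilbertType R) (S : set (V -> V)).
Local Notation C := R[i].
Implicit Types (T A : V -> V).
Hypothesis bS : forall A, S A -> bounded_operator A.

Lemma commutant_mul B T1 T2 : commutant B T1 -> commutant B T2 ->
  commutant B (T1 \o T2).
Proof.
move=> [b1 c1] [b2 c2]; split=> [|A SA]; first exact: bounded_comp.
by rewrite -compA c2 // compA c1.
Qed.

Lemma commutant_scalar (B : set (V -> V)) (c : C) :
  (forall A, B A -> bounded_operator A) -> commutant B (fun x => c *: x).
Proof.
move=> bB; split; first exact: (bounded_scale c (@bounded_id _ V)).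
by move=> A BA; apply/funext => x /=; rewrite linZ //; case: (bB _ BA).
Qed.

Lemma commutant_lin B T1 T2 (c : C) : (forall A, B A -> bounded_operator A) ->
  commutant B T1 -> commutant B T2 -> commutant B (c *: T1 + T2).
Proof.
move=> bB [b1 c1] [b2 c2]; split=> [|A SA].
  by apply: bounded_add => //; exact: bounded_scale.
have lA := (bB _ SA).1; apply/funext => x.
rewrite /= !fctE (linD lA) (linZ lA).
have := congr1 (fun f => f x) (c1 _ SA) => /= ->.
by have := congr1 (fun f => f x) (c2 _ SA) => /= ->.
Qed.

(** Taking adjoints moves the star from the generators to [T], so that membership is checked on the
    generators alone. *)
Lemma commutantP T : commutant (S `|` [set adjoint A | A in S]) T <->
  [/\ bounded_operator T, forall A, S A -> T \o A = A \o T &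
      forall A, S A -> adjoint T \o A = A \o adjoint T].
Proof.
split=> [[bT cT]|[bT cT cT']].
  split=> // A SA; first by apply: cT; left.
  rewrite -[A](adjointK (bS SA)); apply: comm_adjoint => //.
    exact/bounded_adjoint/bS.
  by apply: cT; right; exists A.
split=> // A [/cT//|[B SB <-]].
rewrite -[T](adjointK bT); apply: comm_adjoint; rewrite ?cT' //.
- exact: bounded_adjoint.
- exact: bS.
Qed.

Lemma commutant_adjoint T : commutant (S `|` [set adjoint A | A in S]) T ->
  commutant (S `|` [set adjoint A | A in S]) (adjoint T).
Proof.
move=> /commutantP[bT cT cT']; apply/commutantP; split=> //.
- exact: bounded_adjoint.
- by rewrite adjointK.
Qed.

Lemma generated_bounded T : generated_vN S T -> bounded_operator T.
Proof. by case. Qed.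

Lemma generated_commute T T' : generated_vN S T ->
  commutant (S `|` [set adjoint A | A in S]) T' -> T \o T' = T' \o T.
Proof. by move=> [_ h] /h. Qed.

Lemma generated_sub A : S A -> generated_vN S A.
Proof.
by move=> SA; split=> [|T [_ cT]]; [exact: bS | rewrite cT //; left].
Qed.

Lemma generated_adjoint T : generated_vN S T -> generated_vN S (adjoint T).
Proof.
move=> [bT cT]; split=> [|A cA]; first exact: bounded_adjoint.
have bA : bounded_operator A by case: cA.
rewrite -[A](adjointK bA); apply: comm_adjoint => //.
  exact: bounded_adjoint.
by apply: cT; exact: commutant_adjoint.
Qed.

Lemma generated_comp T1 T2 : generated_vN S T1 -> generated_vN S T2 ->
  generated_vN S (T1 \o T2).
Proof. exact: commutant_mul. Qed.

Lemma generated_lin T1 T2 (c : C) : generated_vN S T1 -> generated_vN S T2 ->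
  generated_vN S (c *: T1 + T2).
Proof. by apply: commutant_lin => A []. Qed.

Lemma generated_scalar (c : C) : generated_vN S (fun x => c *: x).
Proof. by apply: commutant_scalar => A []. Qed.

End VonNeumann.

(** * Operators on kernel spaces *)

Section KernelOperators.
Variables (R : realType) (X : choiceType) (k : psdKernel R X).
Variable W : complexHilbertType R.
Local Notation C := R[i].
Local Notation V := (kernel_space k).
Implicit Types u v : seq (C * X).

Lemma kernel_ext (x y : V) :
  (forall z, inner x (kernel_vec k z) = inner y (kernel_vec k z)) -> x = y.
Proof.
move=> h; apply/val_inj/funext => z /=.
by rewrite -!inner_kernel_vec.
Qed.

(** The adjoints take values in the kernel space, where vectors are determined by their pairings
    with kernel vectors; hence the adjoints agree, and so do [S] and [T]. *)
Lemma kernel_vec_ext (S T : V -> W) :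
  linear S -> continuous S -> linear T -> continuous T ->
  (forall x, S (kernel_vec k x) = T (kernel_vec k x)) -> S = T.
Proof.
move=> lS cS lT cT h.
have [S' [_ _ hS]] := adjoint_pair_exists lS cS.
have [T' [_ _ hT]] := adjoint_pair_exists lT cT.
have ST : S' = T'.
  apply/funext => y; apply: kernel_ext => z.
  by rewrite -innerC -hS h hT innerC.
apply/funext => x; apply: inner_ext => z.
by rewrite -innerC hS ST -hT innerC.
Qed.

Lemma kernel_approx (x : V) : exists u : nat -> seq (C * X), forall n,
  `|x - \sum_(p <- u n) p.1 *: kernel_vec k p.2| <= n.+1%:R^-1.
Proof.
have h n : exists u, `|x - \sum_(p <- u) p.1 *: kernel_vec k p.2| <= n.+1%:R^-1.
  have [|u hu] := @kernel_vec_dense R X k x n.+1%:R^-1.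
    by rewrite invr_gt0.
  by exists u; apply: ltW; move: hu; rewrite fmorphV rmorph_nat.
by exists (fun n => projT1 (cid (h n))) => n; exact: projT2 (cid (h n)).
Qed.

Variables (w : X -> W) (M : C).

Let cv u : V := \sum_(p <- u) p.1 *: kernel_vec k p.2.
Let cw u : W := \sum_(p <- u) p.1 *: w p.2.

Hypothesis M0 : 0 <= M.
Hypothesis hw : forall u, `|cw u| <= M * `|cv u|.

Let lincomb (a : C) u v := [seq (a * p.1, p.2) | p <- u] ++ v.

Let cvL a u v : cv (lincomb a u v) = a *: cv u + cv v.
Proof.
rewrite /cv big_cat /= big_map scaler_sumr; congr (_ + _).
by apply: eq_bigr => p _; rewrite scalerA.
Qed.

Let cwL a u v : cw (lincomb a u v) = a *: cw u + cw v.
Proof.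
rewrite /cw big_cat /= big_map scaler_sumr; congr (_ + _).
by apply: eq_bigr => p _; rewrite scalerA.
Qed.

Let hwB u v : `|cw u - cw v| <= M * `|cv u - cv v|.
Proof.
have := hw (lincomb (-1) v u).
by rewrite cwL cvL !scaleN1r ![- _ + _]addrC.
Qed.

(** The extension by continuity is built as a relation: one sequence of combinations approximates
    [x] in [V] and, with [w] in place of the kernel vectors, [y] in [W]. *)
Let graph x y := exists (u : nat -> seq (C * X)) (K : C),
  0 <= K /\ forall n, `|x - cv (u n)| <= K * n.+1%:R^-1 /\
                      `|y - cw (u n)| <= K * n.+1%:R^-1.

Let graph_ex x : exists y, graph x y.
Proof.
have [u hu] := kernel_approx x.
have [||y hy] := @harmonic_cauchy R W (fun n => cw (u n)) M.
- exact: M0.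
- move=> n m; apply: le_trans (hwB _ _) _; apply: ler_wpM2l => //.
  have -> : cv (u n) - cv (u m) = (x - cv (u m)) - (x - cv (u n)).
    by rewrite opprB [RHS]addrC addrA subrK.
  by rewrite (le_trans (ler_normB _ _)) // [leLHS]addrC lerD //; exact: hu.
exists y, u, (1 + M); split=> [|n]; first exact: addr_ge0.
have n0 : 0 <= n.+1%:R^-1 :> C by rewrite invr_ge0.
split; first by rewrite (le_trans (hu n)) // mulrDl mul1r lerDl mulr_ge0.
by rewrite distrC (le_trans (hy n)) // mulrDl mul1r lerDr.
Qed.

Let graph_lin a x x' y y' : graph x y -> graph x' y' ->
  graph (a *: x + x') (a *: y + y').
Proof.
move=> [u [K [K0 hu]]] [v [L [L0 hv]]].
exists (fun n => lincomb a (u n) (v n)), (`|a| * K + L).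
split=> [|n]; first by rewrite addr_ge0 // mulr_ge0.
have [[u1 u2] [v1 v2]] := (hu n, hv n).
by split; rewrite ?cvL ?cwL opprD addrACA -scalerBr (le_trans (ler_normD _ _)) //
  normrZ mulrDl lerD // -mulrA ler_wpM2l.
Qed.

Let graph_bounded x y : graph x y -> `|y| <= M * `|x|.
Proof.
move=> [u [K [K0 hu]]]; apply: (@harmonic_le _ _ _ (K + M * K)) => n.
have [u1 u2] := hu n.
rewrite -[y](subrK (cw (u n))) (le_trans (ler_normD _ _)) // addrC mulrDl.
rewrite [leRHS](_ : _ = M * `|x| + M * K * n.+1%:R^-1 + K * n.+1%:R^-1);
  last by ring.
rewrite lerD // (le_trans (hw _)) // -mulrA -mulrDr ler_wpM2l //.
rewrite -[cv (u n)](subKr x) (le_trans (ler_normB _ _)) // lerD //.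
Qed.

(** By linearity y' - y is related to 0, and [graph_bounded] makes it vanish. *)
Let graph_uniq x y y' : graph x y -> graph x y' -> y = y'.
Proof.
move=> h /(graph_lin (-1)) /(_ h) /graph_bounded.
rewrite !scaleN1r addNr normr0 mulr0 normr_le0 addrC subr_eq0 => /eqP //.
Qed.

(** The source of all operators given on elementary vectors: creations, second quantizations, shifts
    and diagonal operators. *)
Lemma kernel_extension : exists T : V -> W,
  [/\ linear T, forall x, `|T x| <= M * `|x| &
      forall x, T (kernel_vec k x) = w x].
Proof.
pose T x := projT1 (cid (graph_ex x)).
have TP x : graph x (T x) by exact: projT2 (cid (graph_ex x)).
exists T; split=> [a x y|x|x].
- exact: graph_uniq (TP _) (graph_lin a (TP x) (TP y)).
- exact: graph_bounded.
- apply: graph_uniq (TP _) _; exists (fun=> [:: (1, x)]), 0; split=> // n.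
  by rewrite /cv /cw !big_seq1 !scale1r !subrr !normr0 mul0r.
Qed.

End KernelOperators.

Section KernelIsometry.
Variables (R : realType) (X : choiceType) (k : psdKernel R X).
Variable W : complexHilbertType R.
Local Notation C := R[i].

Lemma sqr_norm_sum (V : complexHilbertType R) (I : Type) (r : seq I) (c : I -> C)
    (v : I -> V) :
  `|\sum_(i <- r) c i *: v i| ^+ 2 =
  \sum_(i <- r) \sum_(j <- r) c i * (c j)^* * inner (v i) (v j).
Proof.
rewrite -inner_norm inner_suml; apply: eq_bigr => i _.
rewrite inner_sumr; apply: eq_bigr => j _.
by rewrite innerZl innerZr mulrA.
Qed.

(** The factor [M] admits multiples of isometries, such as the creation operator of a vector of norm
    [M]. *)
Lemma kernel_isometry (w : X -> W) (M : C) : 0 <= M ->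
  (forall x y, inner (w x) (w y) = M ^+ 2 * k x y) ->
  exists T : kernel_space k -> W,
  [/\ linear T, forall x, `|T x| <= M * `|x| &
      forall x, T (kernel_vec k x) = w x].
Proof.
move=> M0 hw; apply: kernel_extension => // u.
rewrite -(@ler_pXn2r _ 2) ?nnegrE ?mulr_ge0 // exprMn !sqr_norm_sum.
rewrite le_eqVlt; apply/orP; left; apply/eqP.
rewrite mulr_sumr; apply: eq_bigr => p _.
rewrite mulr_sumr; apply: eq_bigr => q _.
by rewrite hw kernel_vecE mulrCA.
Qed.

End KernelIsometry.

(** * Left and right semicircular operators *)

Section RealInner.
Variables (R : realType) (H : realHilbertType R).
Implicit Types (x y z : H).

Lemma rinnerC x y : inner x y = inner y x.
Proof. by rewrite inner_sym. Qed.

Lemma rinnerDl z x y : inner (x + y) z = inner x z + inner y z.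
Proof. by have := inner_linear z 1 x y; rewrite scale1r mul1r. Qed.

Lemma rinner0l z : inner 0 z = 0.
Proof. by apply: (addrI (inner 0 z)); rewrite -rinnerDl !addr0. Qed.

Lemma rinnerZl z a x : inner (a *: x) z = a * inner x z.
Proof. by have := inner_linear z a x 0; rewrite addr0 rinner0l addr0. Qed.

Lemma rinnerNl z x : inner (- x) z = - inner x z.
Proof. by rewrite -scaleN1r rinnerZl mulN1r. Qed.

Lemma rinnerBl z x y : inner (x - y) z = inner x z - inner y z.
Proof. by rewrite rinnerDl rinnerNl. Qed.

Lemma rinnerZr z a x : inner z (a *: x) = a * inner z x.
Proof. by rewrite rinnerC rinnerZl rinnerC. Qed.

Lemma rinnerBr z x y : inner z (x - y) = inner z x - inner z y.
Proof. by rewrite rinnerC rinnerBl !(rinnerC z). Qed.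

Lemma rinner_eq0 x : inner x x = 0 -> x = 0.
Proof.
by rewrite inner_norm => /eqP; rewrite expf_eq0 normr_eq0 => /andP[_ /eqP].
Qed.

Local Notation C := R[i].
Local Notation HC := (complexification H).
Local Notation ci := (@complexification_inner R H).
Implicit Types (u v w : HC) (a : C).

Lemma cinner_linear w a u v : ci (a *: u + v) w = a * ci u w + ci v w.
Proof.
rewrite /complexification_inner; case: a => a1 a2.
rewrite /= !(rinnerDl, rinnerNl, rinnerZl).
by apply/eqP; rewrite eq_complex /=; apply/andP; split; apply/eqP; ring.
Qed.

Lemma cinnerC u v : (ci u v)^* = ci v u.
Proof.
apply/eqP; rewrite eq_complex /= opprB.
by rewrite (rinnerC v.1 u.1) (rinnerC v.2) (rinnerC v.2) (rinnerC v.1) !eqxx.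
Qed.

Lemma cinnerDl w u v : ci (u + v) w = ci u w + ci v w.
Proof. by have := cinner_linear w 1 u v; rewrite scale1r mul1r. Qed.

Lemma cinner0l w : ci 0 w = 0.
Proof. by apply: (addrI (ci 0 w)); rewrite -cinnerDl !addr0. Qed.

Lemma cinnerZl w a u : ci (a *: u) w = a * ci u w.
Proof. by have := cinner_linear w a u 0; rewrite addr0 cinner0l addr0. Qed.

Lemma cinnerBl w u v : ci (u - v) w = ci u w - ci v w.
Proof. by rewrite cinnerDl -scaleN1r cinnerZl mulN1r. Qed.

(** Cauchy-Schwarz for the kernel [ci]. It settles the degenerate case of the orthogonalization in
    [coefficient_eq0]. *)
Lemma cinner_null u v : ci v v = 0 -> ci u v = 0.
Proof.
move=> v0; have gE (a b : HC) : gram ci [:: (1, a)] [:: (1, b)] = ci a b.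
  by rewrite gramE !big_seq1 rmorph1 !mul1r.
have := gram_CS2 (complexification_inner_psd H) [:: (1, u)] [:: (1, v)].
rewrite !gE v0 mulr0 => h; apply/eqP; rewrite -normr_eq0 -sqrf_eq0 eq_le h.
exact: exprn_ge0.
Qed.

Lemma cinner_real x y : ci (complexify x) (complexify y) = (inner x y)%:C%C.
Proof.
by rewrite /complexification_inner /= !rinner0l (rinnerC x 0) rinner0l addr0 subrr.
Qed.

(** Creation operators are indexed by real vectors; with multilinearity this reduces arbitrary
    letters to real ones. *)
Lemma complexify_decomp u : u = complexify u.1 + 'i%C *: complexify u.2.
Proof.
case: u => a b; rewrite /complexify.
change ((a, b) = (a + (0 *: b - 1 *: 0), 0 + (0 *: 0 + 1 *: b)) :> H * H).
by rewrite !scaler0 scale0r scale1r subr0 addr0 !add0r.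
Qed.

End RealInner.

Section TensorInner.
Variables (R : realType) (H : realHilbertType R).
Local Notation C := R[i].
Local Notation HC := (complexification H).
Local Notation ti := (@tensor_inner R H).
Implicit Types (v w z p q : seq HC).

Lemma tensor_inner_size v w : size v != size w -> ti v w = 0.
Proof.
elim: v w => [|x v IH] [|y w] //=; rewrite eqSS => /IH ->.
by rewrite mulr0.
Qed.

Lemma tensor_inner_rcons x y v w :
  ti (rcons v x) (rcons w y) = complexification_inner x y * ti v w.
Proof.
elim: v w => [|a v IH] [|b w] //=.
- case: w => [|c w] /=; rewrite ?mulr0 ?mul0r ?mulr1 //.
- by case: v {IH} => [|c v] /=; rewrite ?mulr0 ?mul0r.
- by rewrite IH mulrCA.
Qed.

Lemma tensor_inner_multilinear p q a (x y : HC) z :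
  ti (p ++ (a *: x + y) :: q) z = a * ti (p ++ x :: q) z + ti (p ++ y :: q) z.
Proof.
elim: p z => [|b p IH] [|c z] /=; rewrite ?mulr0 ?addr0 //.
  by rewrite cinner_linear mulrDl mulrA.
by rewrite IH mulrDr mulrCA.
Qed.

End TensorInner.

Section Words.
Variables (R : realType) (H : realHilbertType R).
Local Notation C := R[i].
Local Notation HC := (complexification H).
Local Notation F := (fock_space H).
Local Notation Omega := (vacuum H).
Implicit Types (v w : seq HC) (xi eta : H).

Lemma tensor_ext (x y : F) :
  (forall w, inner x (tensor w) = inner y (tensor w)) -> x = y.
Proof. exact: kernel_ext. Qed.

Lemma tensor_map_ext (W : complexHilbertType R) (S T : F -> W) :
  linear S -> continuous S -> linear T -> continuous T ->
  (forall w, S (tensor w) = T (tensor w)) -> S = T.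
Proof. exact: kernel_vec_ext. Qed.

Lemma tensor_op_ext (S T : F -> F) :
  bounded_operator S -> bounded_operator T ->
  (forall w, S (tensor w) = T (tensor w)) -> S = T.
Proof. by move=> [? ?] [? ?]; exact: tensor_map_ext. Qed.

Lemma tensor_isometry (W : complexHilbertType R) (f : seq HC -> W) (M : C) :
  0 <= M ->
  (forall v w, inner (f v) (f w) = M ^+ 2 * tensor_inner v w) ->
  exists T : F -> W, [/\ linear T, continuous T & forall w, T (tensor w) = f w].
Proof.
move=> M0 hf.
have [T [lT bT hT]] :=
  @kernel_isometry _ _ (PsdKernel (tensor_inner_psd H)) W f M M0 hf.
by exists T; split=> //; exact: linear_bound_continuous bT.
Qed.

(** Words are formal symbols, but both sides have the same pairings with all words, and the kernel
    space identifies such vectors. *)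
Lemma tensor_multilinear v w a (x y : HC) :
  tensor (v ++ (a *: x + y) :: w) =
  a *: tensor (v ++ x :: w) + tensor (v ++ y :: w) :> F.
Proof.
apply: tensor_ext => z; rewrite innerDl innerZl !tensorE.
exact: tensor_inner_multilinear.
Qed.

Let cnorm xi : C := `|xi|%:C%C.

Let cnorm_ge0 xi : 0 <= cnorm xi.
Proof. by rewrite lecR. Qed.

Let cnormE xi :
  complexification_inner (complexify xi) (complexify xi) = cnorm xi ^+ 2.
Proof. by rewrite cinner_real inner_norm -rmorphXn. Qed.

Lemma creationP xi : bounded_operator (creation xi) /\
  forall w, creation xi (tensor w) = tensor (complexify xi :: w).
Proof.
have [|T [lT cT hT]] := @tensor_isometry F (fun w => tensor (complexify xi :: w))
    (cnorm xi) (cnorm_ge0 xi).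
  by move=> v w; rewrite tensorE /= cnormE.
apply: (@getPex _ [set L | bounded_operator L /\
  forall w, L (tensor w) = tensor (complexify xi :: w)]).
by exists T.
Qed.

Lemma bounded_creation xi : bounded_operator (creation xi).
Proof. by case: (creationP xi). Qed.

Lemma creationE xi w : creation xi (tensor w) = tensor (complexify xi :: w).
Proof. by case: (creationP xi) => _ ->. Qed.

Definition right_creation xi : F -> F :=
  get [set L | bounded_operator L /\
               forall w, L (tensor w) = tensor (rcons w (complexify xi))].

Lemma right_creationP xi : bounded_operator (right_creation xi) /\
  forall w, right_creation xi (tensor w) = tensor (rcons w (complexify xi)).
Proof.
have [|T [lT cT hT]] := @tensor_isometry F
    (fun w => tensor (rcons w (complexify xi))) (cnorm xi) (cnorm_ge0 xi).
  by move=> v w; rewrite tensorE tensor_inner_rcons cnormE.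
apply: (@getPex _ [set L | bounded_operator L /\
  forall w, L (tensor w) = tensor (rcons w (complexify xi))]).
by exists T.
Qed.

Lemma bounded_right_creation xi : bounded_operator (right_creation xi).
Proof. by case: (right_creationP xi). Qed.

Lemma right_creationE xi w :
  right_creation xi (tensor w) = tensor (rcons w (complexify xi)).
Proof. by case: (right_creationP xi) => _ ->. Qed.

Lemma annihilation_nil xi : adjoint (creation xi) Omega = 0.
Proof.
apply: tensor_ext => w.
rewrite inner_adjointl; last exact: bounded_creation.
by rewrite creationE tensorE inner0l.
Qed.

Lemma annihilation_cons xi x w : adjoint (creation xi) (tensor (x :: w)) =
  complexification_inner x (complexify xi) *: tensor w.
Proof.
apply: tensor_ext => z.
rewrite inner_adjointl; last exact: bounded_creation.
by rewrite creationE innerZl !tensorE.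
Qed.

Lemma right_annihilation_nil xi : adjoint (right_creation xi) Omega = 0.
Proof.
apply: tensor_ext => w.
rewrite inner_adjointl; last exact: bounded_right_creation.
by rewrite right_creationE tensorE inner0l; case: w.
Qed.

Lemma right_annihilation_rcons xi x w :
  adjoint (right_creation xi) (tensor (rcons w x)) =
  complexification_inner x (complexify xi) *: tensor w.
Proof.
apply: tensor_ext => z.
rewrite inner_adjointl; last exact: bounded_right_creation.
by rewrite right_creationE innerZl !tensorE tensor_inner_rcons.
Qed.

Definition right_semicircular xi : F -> F :=
  right_creation xi + adjoint (right_creation xi).

Lemma bounded_semicircular xi : bounded_operator (semicircular xi).
Proof.
by apply: bounded_add; [|apply: bounded_adjoint]; exact: bounded_creation.
Qed.

Lemma bounded_right_semicircular xi : bounded_operator (right_semicircular xi).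
Proof.
by apply: bounded_add; [|apply: bounded_adjoint]; exact: bounded_right_creation.
Qed.

Lemma adjoint_semicircular xi : adjoint (semicircular xi) = semicircular xi.
Proof.
have b := bounded_creation xi.
rewrite adjoint_add //; last exact: bounded_adjoint.
by rewrite adjointK // addrC.
Qed.

Lemma adjoint_right_semicircular xi :
  adjoint (right_semicircular xi) = right_semicircular xi.
Proof.
have b := bounded_right_creation xi.
rewrite adjoint_add //; last exact: bounded_adjoint.
by rewrite adjointK // addrC.
Qed.

Lemma semicircularE xi x :
  semicircular xi x = creation xi x + adjoint (creation xi) x.
Proof. by []. Qed.

Lemma right_semicircularE xi x : right_semicircular xi x =
  right_creation xi x + adjoint (right_creation xi) x.
Proof. by []. Qed.

Lemma semicircular_nil xi : semicircular xi Omega = tensor [:: complexify xi].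
Proof. by rewrite semicircularE creationE annihilation_nil addr0. Qed.

Lemma semicircular_cons xi x w : semicircular xi (tensor (x :: w)) =
  tensor (complexify xi :: x :: w) +
  complexification_inner x (complexify xi) *: tensor w.
Proof. by rewrite semicircularE creationE annihilation_cons. Qed.

Lemma right_semicircular_nil xi :
  right_semicircular xi Omega = tensor [:: complexify xi].
Proof.
by rewrite right_semicircularE right_creationE right_annihilation_nil addr0.
Qed.

Lemma right_semicircular_rcons xi x w :
  right_semicircular xi (tensor (rcons w x)) =
  tensor (rcons (rcons w x) (complexify xi)) +
  complexification_inner x (complexify xi) *: tensor w.
Proof. by rewrite right_semicircularE right_creationE right_annihilation_rcons. Qed.

(** The two operators act on opposite ends of a word. The ends interfere only on short words,
    treated apart; at the vacuum the claim is the symmetry of the real inner product. *)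
Lemma semicircular_comm xi eta :
  right_semicircular eta \o semicircular xi =
  semicircular xi \o right_semicircular eta.
Proof.
have bs := bounded_semicircular xi; have br := bounded_right_semicircular eta.
apply: tensor_op_ext => [||w]; [exact: bounded_comp..|].
have [[lr _] [ls _]] := (br, bs).
case: w => [|x w] /=.
  rewrite -/(vacuum H) semicircular_nil right_semicircular_nil.
  rewrite -[[:: complexify xi]]/(rcons [::] (complexify xi)).
  rewrite right_semicircular_rcons semicircular_cons /=.
  by rewrite !cinner_real rinnerC.
rewrite semicircular_cons (linD lr) (linZ lr).
case/lastP: w => [|w y].
  rewrite -/(vacuum H) right_semicircular_nil.
  rewrite -[[:: complexify xi; x]]/(rcons [:: complexify xi] x).
  rewrite right_semicircular_rcons.
  rewrite -[[:: x]]/(rcons [::] x) right_semicircular_rcons.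
  rewrite (linD ls) (linZ ls) semicircular_nil /= semicircular_cons.
  by rewrite addrAC.
rewrite -!rcons_cons !right_semicircular_rcons.
rewrite (linD ls) (linZ ls) !rcons_cons !semicircular_cons !scalerDr !scalerA.
rewrite -!addrA; congr (_ + _); rewrite addrCA; congr (_ + (_ + _)).
by rewrite mulrC.
Qed.

Section Cyclic.
Variable K : F -> Prop.
Hypothesis K_Omega : K Omega.
Hypothesis K_lin : forall a x y, K x -> K y -> K (a *: x + y).

Let K0 : K 0.
Proof. by have := K_lin (-1) K_Omega K_Omega; rewrite scaleN1r addNr. Qed.
Let KZ a x : K x -> K (a *: x).
Proof. by move=> /(K_lin a) /(_ K0); rewrite addr0. Qed.
Let KB x y : K x -> K y -> K (x - y).
Proof. by move=> hx hy; have := K_lin (-1) hy hx; rewrite scaleN1r addrC. Qed.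

(** Cyclicity of the vacuum as an induction principle: [K] is any subspace containing the vacuum and
    stable under the semicircular operators. A creation is a semicircular operator minus an
    annihilation, which only shortens words. *)
Lemma semicircular_cyclic : (forall xi x, K x -> K (semicircular xi x)) ->
  forall w, K (tensor w).
Proof.
(* The induction is on a bound for the length, since the annihilation term has two letters fewer
   than the word to be reached. *)
move=> Ks w; move: {2}(size w) (leqnn (size w)) => n.
elim: n w => [|n IH] [|x w] //= sw.
have h xi : K (tensor (complexify xi :: w)).
  rewrite -creationE.
  have -> : creation xi (tensor w) =
      semicircular xi (tensor w) - adjoint (creation xi) (tensor w).
    by rewrite semicircularE addrK.
  apply: KB; first by apply: Ks; exact: IH.
  case: w sw => [|y w] sw; first by rewrite annihilation_nil.
  by rewrite annihilation_cons; apply/KZ/IH; rewrite ltnW.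
rewrite [x]complexify_decomp addrC -[_ :: w]cat0s tensor_multilinear.
by apply: K_lin; exact: h.
Qed.

Lemma right_semicircular_cyclic :
  (forall xi x, K x -> K (right_semicircular xi x)) -> forall w, K (tensor w).
Proof.
move=> Ks w; move: {2}(size w) (leqnn (size w)) => n.
elim: n w => [|n IH] w; first by case: w.
case/lastP: w => [//|w x]; rewrite size_rcons ltnS => sw.
have h xi : K (tensor (rcons w (complexify xi))).
  rewrite -right_creationE.
  have -> : right_creation xi (tensor w) =
      right_semicircular xi (tensor w) - adjoint (right_creation xi) (tensor w).
    by rewrite right_semicircularE addrK.
  apply: KB; first by apply: Ks; exact: IH.
  case/lastP: w sw => [|w y] sw; first by rewrite right_annihilation_nil.
  rewrite right_annihilation_rcons; apply/KZ/IH.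
  by rewrite (leq_trans _ sw) // size_rcons.
rewrite [x]complexify_decomp addrC -cats1 tensor_multilinear !cats1.
by apply: K_lin; exact: h.
Qed.

End Cyclic.

End Words.

(** * The Bogoljubov action *)

Section SecondQuantization.
Variables (R : realType) (H : realHilbertType R).
Local Notation C := R[i].
Local Notation HC := (complexification H).
Local Notation F := (fock_space H).
Implicit Types (v w : seq HC) (xi eta : H) (alpha beta : H -> H).

Definition complexify_map alpha (x : HC) : HC := (alpha x.1, alpha x.2).

Definition orthogonal_map alpha :=
  linear alpha /\ forall x y, inner (alpha x) (alpha y) = inner x y.

Lemma complexify_map_complexify alpha xi : linear alpha ->
  complexify_map alpha (complexify xi) = complexify (alpha xi).
Proof.
move=> la; have a0 : alpha 0 = 0.
  by have := la (-1) 0 0; rewrite scaler0 addr0 scaleN1r addNr.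
by rewrite /complexify_map /= a0.
Qed.

Lemma tensor_inner_map alpha v w : orthogonal_map alpha ->
  tensor_inner (map (complexify_map alpha) v) (map (complexify_map alpha) w) =
  tensor_inner v w.
Proof.
move=> [_ ia]; elim: v w => [|x v IH] [|y w] //=; rewrite IH.
by rewrite /complexification_inner /= !ia.
Qed.

Definition second_quantization alpha : F -> F :=
  get [set U | bounded_operator U /\
               forall w, U (tensor w) = tensor (map (complexify_map alpha) w)].

Lemma second_quantizationP alpha : orthogonal_map alpha ->
  bounded_operator (second_quantization alpha) /\
  forall w, second_quantization alpha (tensor w) =
            tensor (map (complexify_map alpha) w).
Proof.
move=> oa.
have [||T [lT cT hT]] := @tensor_isometry R H F
    (fun w => tensor (map (complexify_map alpha) w)) 1.
- by [].
- by move=> v w; rewrite tensorE tensor_inner_map // expr1n mul1r.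
apply: (@getPex _ [set U | bounded_operator U /\
  forall w, U (tensor w) = tensor (map (complexify_map alpha) w)]).
by exists T.
Qed.

Lemma bounded_second_quantization alpha : orthogonal_map alpha ->
  bounded_operator (second_quantization alpha).
Proof. by case/second_quantizationP. Qed.

Lemma second_quantizationE alpha w : orthogonal_map alpha ->
  second_quantization alpha (tensor w) = tensor (map (complexify_map alpha) w).
Proof. by case/second_quantizationP => _ ->. Qed.

Lemma second_quantization_vacuum alpha : orthogonal_map alpha ->
  second_quantization alpha (vacuum H) = vacuum H.
Proof. by move=> oa; rewrite second_quantizationE. Qed.

Lemma second_quantization_id : second_quantization id = id.
Proof.
have oid : orthogonal_map (@id H) by [].
apply: tensor_op_ext => [||w].
- exact: bounded_second_quantization.
- exact: bounded_id.
- rewrite second_quantizationE // -[in RHS](map_id w).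
  by congr tensor; apply: eq_map => -[].
Qed.

Lemma orthogonal_comp alpha beta : orthogonal_map alpha -> orthogonal_map beta ->
  orthogonal_map (alpha \o beta).
Proof.
move=> [la ia] [lb ib]; split=> [a x y|x y] /=; first by rewrite lb la.
by rewrite ia ib.
Qed.

Lemma second_quantization_comp alpha beta : orthogonal_map alpha ->
  orthogonal_map beta -> second_quantization (alpha \o beta) =
  second_quantization alpha \o second_quantization beta.
Proof.
move=> oa ob; have oab := orthogonal_comp oa ob.
apply: tensor_op_ext => [||w].
- exact: bounded_second_quantization.
- by apply: bounded_comp; exact: bounded_second_quantization.
- by rewrite /= !second_quantizationE // -map_comp.
Qed.

Lemma second_quantization_semicircular alpha xi : orthogonal_map alpha ->
  second_quantization alpha \o semicircular xi =
  semicircular (alpha xi) \o second_quantization alpha.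
Proof.
move=> oa; have bU := bounded_second_quantization oa.
apply: tensor_op_ext => [||w].
- by apply: bounded_comp => //; exact: bounded_semicircular.
- by apply: bounded_comp => //; exact: bounded_semicircular.
have cE := complexify_map_complexify _ oa.1.
case: w => [|x w] /=.
  rewrite -/(vacuum H) semicircular_nil second_quantization_vacuum //.
  by rewrite semicircular_nil second_quantizationE //= cE.
rewrite semicircular_cons second_quantizationE //= semicircular_cons.
rewrite (linD bU.1) (linZ bU.1) !second_quantizationE //= cE.
by rewrite -cE /complexification_inner /= !oa.2.
Qed.

End SecondQuantization.

(** * The free Gaussian algebra and uniqueness of its action *)

Section FreeGaussianAlgebra.
Variables (R : realType) (H : realHilbertType R).
Local Notation C := R[i].
Local Notation F := (fock_space H).
Local Notation Omega := (vacuum H).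
Local Notation M := (@free_gaussian_vN R H).
Implicit Types (xi eta : H) (x y : F -> F).

Let S : set (F -> F) := [set semicircular xi | xi in [set: H]].

Let bS A : S A -> bounded_operator A.
Proof. by move=> [xi _ <-]; exact: bounded_semicircular. Qed.

Lemma gaussian_bounded x : M x -> bounded_operator x.
Proof. exact: generated_bounded. Qed.

Lemma gaussian_semicircular xi : M (semicircular xi).
Proof. by apply: (generated_sub bS); exists xi. Qed.

Lemma gaussian_comp x y : M x -> M y -> M (x \o y).
Proof. exact: generated_comp. Qed.

Lemma gaussian_adjoint x : M x -> M (adjoint x).
Proof. exact: generated_adjoint. Qed.

Lemma gaussian_lin (c : C) x y : M x -> M y -> M (c *: x + y).
Proof. exact: generated_lin. Qed.

Lemma gaussian_id : M id.
Proof.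
have -> : @id F = (fun v => 1 *: v) by apply/funext => v; rewrite scale1r.
exact: generated_scalar.
Qed.

Lemma gaussian_sub x y : M x -> M y -> M (x - y).
Proof. by move=> mx my; rewrite addrC -scaleN1r; exact: gaussian_lin. Qed.

Lemma right_semicircular_commutant eta :
  commutant (S `|` [set adjoint A | A in S]) (right_semicircular eta).
Proof.
apply/(commutantP bS); rewrite adjoint_right_semicircular.
split=> [|_ [xi _ <-]|_ [xi _ <-]]; first exact: bounded_right_semicircular.
- exact: semicircular_comm.
- exact: semicircular_comm.
Qed.

Lemma gaussian_comm x eta : M x ->
  x \o right_semicircular eta = right_semicircular eta \o x.
Proof.
move=> Mx; apply: generated_commute Mx _; exact: right_semicircular_commutant.
Qed.

(** The vacuum is cyclic for the right semicircular operators, which commute with [M]; hence it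
    separates [M]. *)
Lemma gaussian_separating x y : M x -> M y -> x Omega = y Omega -> x = y.
Proof.
move=> Mx My xy; have [bx by_] := (gaussian_bounded Mx, gaussian_bounded My).
apply: tensor_op_ext => //.
apply: (right_semicircular_cyclic (K := fun v => x v = y v)) => //.
  move=> a u v hu hv.
  by rewrite (linD bx.1) (linD by_.1) (linZ bx.1) (linZ by_.1) hu hv.
move=> xi v hv.
have /(congr1 (@^~ v)) /= -> := gaussian_comm xi Mx.
by have /(congr1 (@^~ v)) /= -> := gaussian_comm xi My; rewrite hv.
Qed.

Lemma gaussian_vacuum_sqr x : M x ->
  `|x Omega| ^+ 2 = vacuum_state (adjoint x \o x).
Proof.
move=> Mx; rewrite -inner_norm /vacuum_state /= inner_adjointl //.
exact: gaussian_bounded.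
Qed.

Section Action.
Variable sigma : int -> (F -> F) -> (F -> F).
Hypothesis hs : trace_preserving_action sigma.

Lemma action_sub n x y : M x -> M y -> sigma n (x - y) = sigma n x - sigma n y.
Proof.
move=> Mx My; rewrite addrC -scaleN1r (action_linear hs) //.
by rewrite scaleN1r addrC.
Qed.

Lemma action_isometry n x y : M x -> M y ->
  `|sigma n x Omega - sigma n y Omega| = `|x Omega - y Omega|.
Proof.
move=> Mx My; have Mxy := gaussian_sub Mx My.
have Ms := action_stable hs n Mxy.
apply/eqP; rewrite -(@eqrXn2 _ 2) //; apply/eqP.
have -> : x Omega - y Omega = (x - y) Omega by [].
have -> : sigma n x Omega - sigma n y Omega = (sigma n (x - y)) Omega.
  by rewrite action_sub.
rewrite !gaussian_vacuum_sqr // -(action_adjoint hs) // -(action_mul hs) //.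
  by rewrite (action_trace hs) //; exact: gaussian_comp (gaussian_adjoint Mxy) Mxy.
exact: gaussian_adjoint.
Qed.

(** Unitality follows from the group law: id is the image under [sigma n] of some y in [M], and
    applying [sigma n] to id \o y = y shows that [sigma n id] fixes it. *)
Lemma action_id n : sigma n id = id.
Proof.
have Mi := gaussian_id; have Mn := action_stable hs (- n) Mi.
have e : sigma n (sigma (- n) id) = id.
  by rewrite -(actionD hs) // subrr (action0 hs).
have := action_mul hs n Mi Mn; rewrite e => h.
by rewrite -[LHS]/(sigma n id \o id) -h.
Qed.

End Action.

(* Trace preservation makes x Omega |-> sigma n x Omega isometric, so both sides
   agree at Omega as soon as they agree on a subalgebra N with N Omega dense. *)
Lemma action_unique (sigma sigma' : int -> (F -> F) -> (F -> F)) n x :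
  trace_preserving_action sigma -> trace_preserving_action sigma' ->
  (forall xi, sigma n (semicircular xi) = sigma' n (semicircular xi)) ->
  M x -> sigma n x = sigma' n x.
Proof.
move=> hs hs' ss Mx.
apply: gaussian_separating; [exact: (action_stable hs)|exact: (action_stable hs')|].
apply/eqP; rewrite -subr_eq0 -normr_eq0; apply/eqP/(@harmonic_eq0 _ _ 2) => m.
rewrite normr_id.
(* [K] is the subspace N Omega; cyclicity will put every word into it. *)
pose K v := exists2 y, M y /\ sigma n y = sigma' n y & v = y Omega.
have K_lin a u v : K u -> K v -> K (a *: u + v).
  move=> [y [My ey] ->] [z [Mz ez] ->]; exists (a *: y + z) => //.
  split; first exact: gaussian_lin.
  by rewrite (action_linear hs) // (action_linear hs') // ey ez.
have K_Omega : K Omega.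
  by exists id => //; split; [exact: gaussian_id | rewrite !action_id].
have Kt w : K (tensor w).
  apply: semicircular_cyclic => // xi v [y [My ey] ->].
  have Ms := gaussian_semicircular xi.
  exists (semicircular xi \o y) => //; split; first exact: gaussian_comp.
  by rewrite (action_mul hs) // (action_mul hs') // ey ss.
have [u hu] := @kernel_approx _ _ (PsdKernel (tensor_inner_psd H)) (x Omega).
have {hu} := hu m; set s := \sum_(p <- _) _ => hu.
have [y [My ey] sE] : K s.
  rewrite /s; elim: (u m) => [|p v IH].
    rewrite big_nil; have := K_lin (-1) _ _ K_Omega K_Omega.
    by rewrite scaleN1r addNr.
  by rewrite big_cons; apply: K_lin; [exact: Kt | exact: IH].
(* Insert the common image of [y]; each of the two isometric actions contributes one error 1/(m+1),
   whence the constant 2. *)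
rewrite -(subrK (sigma n y Omega) (sigma n x Omega)) -addrA.
apply: le_trans (ler_normD _ _) _.
rewrite {2}ey action_isometry // [X in _ + X]distrC action_isometry //.
by rewrite mulr_natl mulr2n lerD // -sE; exact: hu.
Qed.

End FreeGaussianAlgebra.

Section Bogoljubov.
Variables (R : realType) (H : realHilbertType R) (pi : int -> H -> H).
Hypothesis hpi : orthogonal_representation pi.
Local Notation C := R[i].
Local Notation F := (fock_space H).
Local Notation Omega := (vacuum H).
Local Notation M := (@free_gaussian_vN R H).

Lemma orthogonal_pi n : orthogonal_map (pi n).
Proof.
by split; [exact: (representation_linear hpi)|exact: (representation_isometry hpi)].
Qed.

Definition fock_rep n : F -> F := second_quantization (pi n).

Lemma bounded_fock_rep n : bounded_operator (fock_rep n).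
Proof. exact/bounded_second_quantization/orthogonal_pi. Qed.

Lemma fock_repE n w :
  fock_rep n (tensor w) = tensor (map (complexify_map (pi n)) w).
Proof. exact/second_quantizationE/orthogonal_pi. Qed.

Lemma fock_rep0 : fock_rep 0 = id.
Proof. by rewrite /fock_rep (representation0 hpi) second_quantization_id. Qed.

Lemma fock_repD m n : fock_rep (m + n) = fock_rep m \o fock_rep n.
Proof.
rewrite /fock_rep (representationD hpi) second_quantization_comp //;
exact: orthogonal_pi.
Qed.

Lemma fock_repK n x : fock_rep (- n) (fock_rep n x) = x.
Proof.
have := congr1 (fun f => f x) (fock_repD (- n) n).
by rewrite addNr fock_rep0.
Qed.

Lemma fock_repVK n x : fock_rep n (fock_rep (- n) x) = x.
Proof. by have := fock_repK (- n) x; rewrite opprK. Qed.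

Lemma inner_fock_rep n x y : inner (fock_rep n x) y = inner x (fock_rep (- n) y).
Proof.
have bU := bounded_fock_rep n; rewrite -inner_adjointr //.
suff -> : adjoint (fock_rep n) = fock_rep (- n) by [].
apply: tensor_op_ext => [||w].
- exact: bounded_adjoint.
- exact: bounded_fock_rep.
apply: tensor_ext => z; rewrite inner_adjointl //.
rewrite !fock_repE !tensorE.
rewrite -[RHS](tensor_inner_map _ _ (orthogonal_pi n)) -map_comp.
congr tensor_inner; rewrite -[LHS]map_id; apply: eq_map => -[a b].
by rewrite /complexify_map /=; have /(congr1 (fun f => (f a, f b))) :=
  representationD hpi n (- n); rewrite subrr (representation0 hpi).
Qed.

Lemma fock_rep_vacuum n : fock_rep n Omega = Omega.
Proof. exact/second_quantization_vacuum/orthogonal_pi. Qed.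

Lemma fock_rep_isometry n x : `|fock_rep n x| = `|x|.
Proof.
by apply/eqP; rewrite -(@eqrXn2 _ 2) // -!inner_norm inner_fock_rep fock_repK.
Qed.

Lemma fock_rep_semicircular n xi :
  fock_rep n \o semicircular xi = semicircular (pi n xi) \o fock_rep n.
Proof. exact/second_quantization_semicircular/orthogonal_pi. Qed.

Definition bogoljubov n (x : F -> F) : F -> F := fock_rep n \o x \o fock_rep (- n).

Lemma bounded_bogoljubov n x :
  bounded_operator x -> bounded_operator (bogoljubov n x).
Proof.
move=> bx; apply: bounded_comp (bounded_fock_rep _).
exact: bounded_comp (bounded_fock_rep _) bx.
Qed.

Lemma bogoljubov_comp n x y :
  bogoljubov n (x \o y) = bogoljubov n x \o bogoljubov n y.
Proof. by apply/funext => v; rewrite /bogoljubov /= fock_repK. Qed.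

Lemma bogoljubov_adjoint n x : bounded_operator x ->
  adjoint (bogoljubov n x) = bogoljubov n (adjoint x).
Proof.
move=> bx; apply: adjoint_unique; first exact: bounded_bogoljubov.
move=> u v; rewrite /bogoljubov /= inner_fock_rep -inner_adjointr //.
by rewrite inner_fock_rep opprK.
Qed.

Lemma bogoljubov_semicircular n xi :
  bogoljubov n (semicircular xi) = semicircular (pi n xi).
Proof.
apply/funext => v; rewrite /bogoljubov /=.
by have /(congr1 (@^~ (fock_rep (- n) v))) /= -> := fock_rep_semicircular n xi;
  rewrite fock_repVK.
Qed.

Lemma bogoljubovD m n x : bogoljubov (m + n) x = bogoljubov m (bogoljubov n x).
Proof.
by rewrite /bogoljubov fock_repD [- (m + n)]opprD [- m - n]addrC fock_repD.
Qed.

Lemma bogoljubov0 x : bogoljubov 0 x = x.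
Proof. by rewrite /bogoljubov oppr0 fock_rep0. Qed.

Lemma bogoljubovK n x : bogoljubov (- n) (bogoljubov n x) = x.
Proof. by rewrite -bogoljubovD addNr bogoljubov0. Qed.

Let S : set (F -> F) := [set semicircular xi | xi in [set: H]].

Let bS A : S A -> bounded_operator A.
Proof. by move=> [xi _ <-]; exact: bounded_semicircular. Qed.

(** Conjugation by [fock_rep (- n)] permutes the generators and so preserves their commutant. Thus
    [x] commutes with the conjugate of [y]; conjugating back gives the claim. *)
Lemma bogoljubov_stable n x : M x -> M (bogoljubov n x).
Proof.
move=> Mx; split=> [|y]; first exact/bounded_bogoljubov/gaussian_bounded.
move=> /(commutantP bS)[b_y cy cy'].
have cz : commutant (S `|` [set adjoint A | A in S]) (bogoljubov (- n) y).
  have h z : (forall A, S A -> z \o A = A \o z) ->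
      forall A, S A -> bogoljubov (- n) z \o A = A \o bogoljubov (- n) z.
    move=> cz _ [xi _ <-].
    have -> : semicircular xi = bogoljubov (- n) (semicircular (pi n xi)).
      by rewrite -bogoljubov_semicircular bogoljubovK.
    by rewrite -!bogoljubov_comp cz //; exists (pi n xi).
  apply/(commutantP bS); split; first exact: bounded_bogoljubov.
    exact: h.
  by rewrite bogoljubov_adjoint //; exact: h.
have := generated_commute Mx cz.
move=> /(congr1 (bogoljubov n)).
rewrite (bogoljubov_comp n x) (bogoljubov_comp n _ x).
by have := bogoljubovK (- n) y; rewrite opprK => ->.
Qed.

Lemma bogoljubov_action : trace_preserving_action bogoljubov.
Proof.
split=> [n x|n a x y Mx My|n x y _ _|n x Mx|x _|m n x _|n x Mx].
- exact: bogoljubov_stable.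
- apply/funext => v; have [lU _] := bounded_fock_rep n.
  by rewrite /bogoljubov /= !fctE (linD lU) (linZ lU).
- exact: bogoljubov_comp.
- by rewrite bogoljubov_adjoint //; exact: gaussian_bounded.
- exact: bogoljubov0.
- exact: bogoljubovD.
- by rewrite /vacuum_state /bogoljubov /= inner_fock_rep !fock_rep_vacuum.
Qed.

(** Conjugation by the unitaries [fock_rep n] shows that the described action exists, and
    [action_unique] identifies the two on [M]. *)
Lemma free_gaussian_actionE n x : M x ->
  free_gaussian_action pi n x = bogoljubov n x.
Proof.
have [hs hg] : trace_preserving_action (free_gaussian_action pi) /\
    forall n xi, free_gaussian_action pi n (semicircular xi) = semicircular (pi n xi).
  apply: (@getPex _ [set sigma | trace_preserving_action sigma /\
    forall n xi, sigma n (semicircular xi) = semicircular (pi n xi)]).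
  exists bogoljubov; split; first exact: bogoljubov_action.
  exact: bogoljubov_semicircular.
apply: action_unique => //; first exact: bogoljubov_action.
by move=> xi; rewrite hg bogoljubov_semicircular.
Qed.

End Bogoljubov.

(** * The crossed product *)

Section LtwoOperators.
Variables (R : realType) (F : complexHilbertType R).
Local Notation C := R[i].
Local Notation L2 := (ltwo_space F).
Implicit Types (m n : int) (v : F).

Lemma ltwo_ext (x y : L2) :
  (forall n v, inner x (delta n v) = inner y (delta n v)) -> x = y.
Proof. by move=> h; apply: kernel_ext => -[n v]; exact: h. Qed.

Lemma ltwo_op_ext (S T : L2 -> L2) : bounded_operator S -> bounded_operator T ->
  (forall n v, S (delta n v) = T (delta n v)) -> S = T.
Proof.
by move=> [? ?] [? ?] h; apply: kernel_vec_ext => // -[n v]; exact: h.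
Qed.

Lemma delta_linear n : linear (@delta R F n).
Proof.
move=> a x y; apply: ltwo_ext => m v.
by rewrite innerDl innerZl !deltaE innerDl innerZl mulrDr mulrCA.
Qed.

Lemma norm_delta n v : `|delta n v| = `|v|.
Proof.
by apply/eqP; rewrite -(@eqrXn2 _ 2) // -!inner_norm deltaE eqxx mul1r.
Qed.

Lemma delta_continuous n : continuous (@delta R F n).
Proof.
apply: (linear_bound_continuous (@delta_linear n) (M := 1)) => v.
by rewrite norm_delta mul1r.
Qed.

(** Pythagoras, after collecting the terms in the same coordinate. The map [f] is the second
    projection for a vector, and the fibre operator for its image under a diagonal operator. *)
Lemma sqr_norm_delta_sum (u : seq (C * (int * F))) (f : int * F -> F) :
  `|\sum_(p <- u) p.1 *: delta p.2.1 (f p.2)| ^+ 2 =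
  \sum_(n <- undup [seq p.2.1 | p <- u])
    `|\sum_(p <- u) (p.1 * (p.2.1 == n)%:R) *: f p.2| ^+ 2.
Proof.
rewrite sqr_norm_sum.
under [RHS]eq_bigr do rewrite sqr_norm_sum.
rewrite [RHS]exchange_big big_seq [RHS]big_seq /=; apply: eq_bigr => p pu.
have pn : p.2.1 \in undup [seq p.2.1 | p <- u].
  by rewrite mem_undup; apply/mapP; exists p.
rewrite (bigD1_seq p.2.1) ?undup_uniq //= [X in _ = _ + X]big1 => [|n].
  rewrite addr0; apply: eq_bigr => q _.
  by rewrite deltaE eqxx mulr1 rmorphM /= conjC_nat eq_sym; ring.
rewrite eq_sym => /negPf pn'.
by rewrite big1 // => q _; rewrite pn' mulr0 !mul0r.
Qed.

Lemma diagonal_operator (A : int -> F -> F) (M : C) : 0 <= M ->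
  (forall n, linear (A n)) -> (forall n v, `|A n v| <= M * `|v|) ->
  exists T : L2 -> L2, bounded_operator T /\
    forall n v, T (delta n v) = delta n (A n v).
Proof.
move=> M0 lA bA.
have [|T [lT bT hT]] := @kernel_extension R _ (PsdKernel (ltwo_inner_psd F)) L2
    (fun p => delta p.1 (A p.1 p.2)) M M0.
  move=> u; rewrite -(@ler_pXn2r _ 2) ?nnegrE ?mulr_ge0 // exprMn.
  have := @sqr_norm_delta_sum u (fun p => A p.1 p.2); rewrite /= => ->.
  have -> : `|\sum_(p <- u) p.1 *: kernel_vec (PsdKernel (ltwo_inner_psd F)) p.2| =
      `|\sum_(p <- u) p.1 *: delta p.2.1 p.2.2|.
    by congr `|_|; apply: eq_bigr => -[c [n v]].
  have := @sqr_norm_delta_sum u snd; rewrite /= => ->.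
  rewrite mulr_sumr; apply: ler_sum => n _; rewrite -exprMn.
  rewrite ler_pXn2r ?nnegrE ?mulr_ge0 //; apply: le_trans (bA n _).
  rewrite (lin_sum (lA n)) le_eqVlt; apply/orP; left; apply/eqP; congr `|_|.
  apply: eq_bigr => p _; rewrite (linZ (lA n)).
  by case: eqP => [->//|_]; rewrite mulr0 !scale0r.
exists T; split; last by move=> n v; exact: (hT (n, v)).
by split=> //; exact: linear_bound_continuous bT.
Qed.

Lemma crossed_shiftP m : bounded_operator (@crossed_shift R F m) /\
  forall n v, crossed_shift m (delta n v) = delta (m + n) v.
Proof.
apply: (@getPex _ [set T | bounded_operator T /\
  forall n v, T (delta n v) = delta (m + n) v]).
have [||T [lT bT hT]] := @kernel_isometry R _ (PsdKernel (ltwo_inner_psd F)) L2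
    (fun p => delta (m + p.1) p.2) 1.
- by [].
- move=> p q; rewrite deltaE expr1n mul1r /= /ltwo_inner.
  by rewrite (inj_eq (addrI m)).
exists T; split; last by move=> n v; exact: (hT (n, v)).
by split=> //; exact: linear_bound_continuous bT.
Qed.

Lemma bounded_shift m : bounded_operator (@crossed_shift R F m).
Proof. by case: (crossed_shiftP m). Qed.

Lemma crossed_shiftE m n v : crossed_shift m (delta n v) = delta (m + n) v.
Proof. by case: (crossed_shiftP m) => _ ->. Qed.

Lemma adjoint_shift m : adjoint (@crossed_shift R F m) = crossed_shift (- m).
Proof.
have bs := bounded_shift.
apply: ltwo_op_ext => [||n v]; [exact: bounded_adjoint|by []|].
apply: ltwo_ext => k w.
rewrite (inner_adjointl _ _ (bs m)) !crossed_shiftE !deltaE.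
by rewrite -(inj_eq (addrI m) (- m + n)) addrA subrr add0r.
Qed.

Lemma shift_comm m n :
  crossed_shift m \o crossed_shift n =
  crossed_shift n \o crossed_shift m :> (L2 -> L2).
Proof.
have bs := bounded_shift.
apply: ltwo_op_ext => [||k v]; [exact: bounded_comp..|].
by rewrite /= !crossed_shiftE addrCA.
Qed.

Lemma crossed_embeddingP (sigma : int -> (F -> F) -> (F -> F)) x (M : C) :
  0 <= M -> (forall n, linear (sigma n x)) ->
  (forall n v, `|sigma n x v| <= M * `|v|) ->
  bounded_operator (crossed_embedding sigma x) /\
  forall n v, crossed_embedding sigma x (delta n v) = delta n (sigma (- n) x v).
Proof.
move=> M0 l b; apply: (@getPex _ [set T | bounded_operator T /\
  forall n v, T (delta n v) = delta n (sigma (- n) x v)]).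
exact: diagonal_operator M0 (fun n => l (- n)) (fun n => b (- n)).
Qed.

(* With the trivial action, crossed_embedding is x |-> 1 (x) x. *)
Definition amplification (x : F -> F) : L2 -> L2 := crossed_embedding (fun=> id) x.

Lemma amplificationP x : bounded_operator x ->
  bounded_operator (amplification x) /\
  forall n v, amplification x (delta n v) = delta n (x v).
Proof.
move=> [lx cx]; have [M M0 hM] := linear_continuous_bounded lx cx.
exact: (@crossed_embeddingP (fun=> id) x M).
Qed.

Lemma amplification_selfadjoint x : bounded_operator x -> adjoint x = x ->
  adjoint (amplification x) = amplification x.
Proof.
move=> bx xx; have [bT TE] := amplificationP bx.
apply: ltwo_op_ext => [||n v]; [exact: bounded_adjoint|by []|].
apply: ltwo_ext => k w; rewrite (inner_adjointl _ _ bT) !TE !deltaE.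
by rewrite -{2}xx inner_adjointl.
Qed.

End LtwoOperators.

(** * Central elements of the crossed product *)

Section CrossedGaussian.
Variables (R : realType) (H : realHilbertType R) (pi : int -> H -> H).
Hypothesis hpi : orthogonal_representation pi.
Local Notation C := R[i].
Local Notation F := (fock_space H).
Local Notation L2 := (ltwo_space F).
Local Notation Omega := (vacuum H).
Local Notation M := (@free_gaussian_vN R H).
Local Notation Mpi := (free_gaussian_crossed_product pi).
Local Notation emb := (crossed_embedding (free_gaussian_action pi)).
Local Notation lambda := (@crossed_shift R F).
Implicit Types (x : F -> F) (T : L2 -> L2).

Lemma embeddingP x : M x -> bounded_operator (emb x) /\
  forall n v, emb x (delta n v) = delta n (bogoljubov pi (- n) x v).
Proof.
move=> Mx; have [lx cx] := gaussian_bounded Mx.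
have [K K0 hK] := linear_continuous_bounded lx cx.
have [||b E] := @crossed_embeddingP _ _ (free_gaussian_action pi) x K K0.
- move=> n; rewrite free_gaussian_actionE //.
  by case: (bounded_bogoljubov hpi n (gaussian_bounded Mx)).
- move=> n v; rewrite free_gaussian_actionE // /bogoljubov /=.
  by rewrite fock_rep_isometry // -(fock_rep_isometry hpi (- n) v); exact: hK.
by split=> // n v; rewrite E free_gaussian_actionE.
Qed.

Definition crossed_generators : set (L2 -> L2) :=
  [set emb x | x in M] `|` [set lambda m | m in [set: int]].

Lemma crossed_generators_bounded A : crossed_generators A -> bounded_operator A.
Proof.
move=> [[x Mx <-]|[m _ <-]]; last exact: bounded_shift.
by case: (embeddingP Mx).
Qed.

Lemma crossed_embedding_mem x : M x -> Mpi (emb x).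
Proof.
move=> Mx; apply: (generated_sub crossed_generators_bounded).
by left; exists x.
Qed.

Lemma crossed_shift_mem m : Mpi (lambda m).
Proof.
by apply: (generated_sub crossed_generators_bounded); right; exists m.
Qed.

Lemma crossed_commutantP T : bounded_operator T ->
  (forall A, crossed_generators A -> T \o A = A \o T) ->
  (forall A, crossed_generators A -> adjoint T \o A = A \o adjoint T) ->
  commutant (crossed_generators `|` [set adjoint A | A in crossed_generators]) T.
Proof. by move=> *; apply/(commutantP crossed_generators_bounded). Qed.

(** If pi n = id then [fock_rep] is periodic with period [n], so [emb x] acts in the same way on the
    coordinates k and n + k. *)
Lemma shift_commutes_generators n : pi n = id ->
  forall A, crossed_generators A -> lambda n \o A = A \o lambda n.
Proof.
move=> pn _ [[x Mx <-]|[m _ <-]]; last exact: shift_comm.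
have [b E] := embeddingP Mx; have bs := bounded_shift F n.
apply: ltwo_op_ext => [||k v]; [exact: bounded_comp..|].
rewrite /= E !crossed_shiftE E.
have h j : fock_rep pi (n + j) = fock_rep pi j.
  by rewrite fock_repD // {1}/fock_rep pn second_quantization_id.
rewrite /bogoljubov opprK opprK h.
by rewrite -{1}(h (- (n + k))) opprD addNKr.
Qed.

Lemma factor_faithful : is_factor Mpi -> faithful_representation pi.
Proof.
move=> hf n n0 pn.
(* The adjoint of [lambda n] is [lambda (- n)], so commutation is needed for both signs. *)
have pn' : pi (- n) = id.
  have := representationD hpi (- n) n.
  by rewrite addNr (representation0 hpi) pn => ->.
have : (Mpi `&` commutant Mpi) (lambda n).
  split; first exact: crossed_shift_mem.
  split=> [|A MA]; first exact: bounded_shift.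
  apply/esym; apply: generated_commute MA _.
  apply: crossed_commutantP; first exact: bounded_shift.
    exact: shift_commutes_generators.
  by rewrite adjoint_shift; exact: shift_commutes_generators.
(* The shift has matrix coefficient 1 here, while a scalar has coefficient 0 because n <> 0. *)
rewrite hf => -[c] /(congr1 (fun T => inner (T (delta 0 Omega)) (delta n Omega))).
rewrite crossed_shiftE innerZl !deltaE addr0 eqxx tensorE /= mulr1.
by rewrite eq_sym (negPf n0) mul0r mulr0 => /eqP; rewrite oner_eq0.
Qed.

(** In each coordinate [emb x] acts by an element of [M], which commutes with
    [right_semicircular eta]; a shift does not touch the fibres. *)
Lemma right_semicircular_crossed eta :
  commutant (crossed_generators `|` [set adjoint A | A in crossed_generators])
    (amplification (right_semicircular eta)).
Proof.
have br := bounded_right_semicircular eta.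
have [b E] := amplificationP br.
have comm A : crossed_generators A ->
    amplification (right_semicircular eta) \o A =
    A \o amplification (right_semicircular eta).
  move=> [[x Mx <-]|[m _ <-]].
    have [bx Ex] := embeddingP Mx.
    apply: ltwo_op_ext => [||k v]; [exact: bounded_comp..|].
    rewrite /= Ex !E Ex.
    have := gaussian_comm eta (bogoljubov_stable hpi (- k) Mx).
    by move=> /(congr1 (fun f => f v)) /= ->.
  have bs := bounded_shift F m.
  apply: ltwo_op_ext => [||k v]; [exact: bounded_comp..|].
  by rewrite /= !crossed_shiftE !E crossed_shiftE.
apply: crossed_commutantP => //.
by rewrite amplification_selfadjoint // adjoint_right_semicircular.
Qed.

(* The n-th Fourier coefficient zeta of a central element intertwines the left
   semicircular operators twisted by pi (- n) with the right ones. *)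
Lemma central_coefficient T n : Mpi T -> commutant Mpi T ->
  exists zeta : F, (forall v, inner v zeta = inner (delta n v) (T (delta 0 Omega))) /\
    forall eta v, inner (semicircular (pi (- n) eta) v) zeta =
                  inner (right_semicircular eta v) zeta.
Proof.
move=> MT [bT cT].
(* The adjoint [D] of the embedding [delta n] reads off the [n]-th coordinate. *)
have [D [lD cD hD]] :=
  adjoint_pair_exists (@delta_linear R F n) (@delta_continuous R F n).
exists (D (T (delta 0 Omega))); split=> [v|eta v]; first by rewrite hD.
set z0 := T _; rewrite -(hD (semicircular _ v) z0).
rewrite -(hD (right_semicircular eta v) z0).
have Ms := gaussian_semicircular eta.
have [bx Ex] := embeddingP Ms.
have br := bounded_right_semicircular eta.
have [b E] := amplificationP br.
rewrite -(bogoljubov_semicircular hpi (- n) eta) -(Ex n v) -(E n v).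
move: (delta n v) => d.
have asa := amplification_selfadjoint br (adjoint_right_semicircular eta).
have xsa : adjoint (emb (semicircular eta)) = emb (semicircular eta).
  apply: ltwo_op_ext => [||k w]; [exact: bounded_adjoint|by []|].
  apply: ltwo_ext => j z; rewrite (inner_adjointl _ _ bx) !Ex !deltaE.
  case: eqP => [->|_]; last by rewrite !mul0r.
  rewrite (bogoljubov_semicircular hpi (- j) eta); congr (_ * _).
  apply: esym; exact: (inner_selfadjoint _ _ (bounded_semicircular _)
    (adjoint_semicircular _)).
rewrite (inner_selfadjoint d z0 bx xsa) (inner_selfadjoint d z0 b asa) /z0.
(* Both operators commute with [T], the first because [T] is in the commutant and the second because
   [T] is in the algebra, and they agree at [delta 0 Omega]. *)
suff -> : emb (semicircular eta) (T (delta 0 Omega)) =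
    amplification (right_semicircular eta) (T (delta 0 Omega)) by [].
have /(congr1 (fun f => f (delta 0 Omega))) /= <- := cT _ (crossed_embedding_mem Ms).
have /(congr1 (fun f => f (delta 0 Omega))) /= <- :=
  generated_commute MT (right_semicircular_crossed eta).
by rewrite Ex E oppr0 bogoljubov0 // semicircular_nil right_semicircular_nil.
Qed.

(** [T] commutes with the embedded semicircular operators, which reach the whole coordinate 0 from
    [delta 0 Omega], and with the shifts, which reach the other coordinates. *)
Lemma central_scalar T c : Mpi T -> commutant Mpi T ->
  T (delta 0 Omega) = c *: delta 0 Omega -> T = (fun u => c *: u).
Proof.
move=> MT [bT cT] T0.
have Tc n v : T (delta n v) = c *: delta n v.
  suff h w : T (delta 0 (tensor w)) = c *: delta 0 (tensor w).
    have {}h : T \o @delta R F 0 = (fun u => c *: u) \o @delta R F 0.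
      have bc := bounded_scale c (@bounded_id _ L2).
      apply: tensor_map_ext => [a x y|x|a x y|x|w]; last exact: h.
      - by rewrite /= delta_linear bT.1.
      - by apply: continuous_comp; [exact: delta_continuous|exact: bT.2].
      - by rewrite /= delta_linear scalerDr !scalerA mulrC.
      - by apply: continuous_comp; [exact: delta_continuous|exact: bc.2].
    have := congr1 (fun f => f (delta 0 v)) (cT _ (crossed_shift_mem n)).
    rewrite /= crossed_shiftE addr0 => ->.
    have := congr1 (fun f => f v) h => /= ->.
    by rewrite (linZ (bounded_shift F n).1) crossed_shiftE addr0.
  apply: (semicircular_cyclic (K := fun v => T (delta 0 v) = c *: delta 0 v)) => //.
    move=> a x y hx hy; rewrite delta_linear bT.1 hx hy.
    by rewrite scalerDr !scalerA mulrC.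
  move=> xi x hx; have Ms := gaussian_semicircular xi.
  have [bx Ex] := embeddingP Ms.
  have := congr1 (fun f => f (delta 0 x)) (cT _ (crossed_embedding_mem Ms)).
  rewrite /= Ex oppr0 bogoljubov0 // => ->.
  by rewrite hx (linZ bx.1) Ex oppr0 bogoljubov0.
apply: ltwo_op_ext => //.
exact: (bounded_scale c (@bounded_id _ L2)).
Qed.

End CrossedGaussian.

(** * Intertwiners of left and right semicircular operators *)

Section DiscreteWave.
Variables (R : realType).
Local Notation C := R[i].

(* k solves the discrete wave equation on the quarter plane, with the boundary
   values k (-1) j = c * k 0 (j - 1) and k i (-1) = c * k (i - 1) 0. *)
Lemma discrete_wave_eq0 (k : nat -> nat -> C) (c K : C) : c != 1 ->
  k 1%N 0%N = k 0%N 1%N ->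
  (forall j, k 1%N j.+1 + c * k 0%N j = k 0%N j.+2 + k 0%N j) ->
  (forall i, k i.+2 0%N + k i 0%N = k i.+1 1%N + c * k i 0%N) ->
  (forall i j, k i.+2 j.+1 + k i j.+1 = k i.+1 j.+2 + k i.+1 j) ->
  (forall m : nat, exists N, forall i j, (N <= i + j)%N ->
    `|k i j| <= K * m.+1%:R^-1) ->
  forall i j, k i j = 0.
Proof.
move=> c1 k10 kl kr kw kdecay.
(* The wave equation makes this difference constant along diagonals, and the
   decay of k then makes it vanish. *)
have Dconst n i : k (n.+2 + i)%N i - k (n.+1 + i)%N i.+1 = k n.+2 0%N - k n.+1 1%N.
  elim: i => [|i <-]; first by rewrite !addn0.
  have := kw (n.+1 + i)%N i; rewrite !addnS !addSn => h.
  by apply/eqP; rewrite subr_eq addrAC eq_sym subr_eq h addrC.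
have D0 n : k n.+2 0%N = k n.+1 1%N.
  apply/eqP; rewrite -subr_eq0; apply/eqP/(@harmonic_eq0 _ _ (2 * K)) => m.
  have [N hN] := kdecay m; rewrite -(Dconst n N) (le_trans (ler_normB _ _)) //.
  rewrite -mulrA mulr_natl mulr2n lerD // hN //.
    by rewrite leq_addl.
  by rewrite addnS leqW // leq_addl.
(* With [D0] the boundary equation [kr] reduces to k i 0 = c * k i 0. *)
have k0 i : k i 0%N = 0.
  have := kr i; rewrite D0 => /addrI/eqP.
  rewrite -subr_eq0 -{1}[k i 0%N]mul1r -mulrBl mulf_eq0 subr_eq0.
  by rewrite eq_sym (negPf c1) => /eqP.
move=> i j.
(* The equation is of second order, so the induction carries two consecutive values of [j]. *)
suff : (forall i, k i j = 0) /\ (forall i, k i j.+1 = 0) by case.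
elim: j {i} => [|j [IH0 IH1]]; split=> // i.
  case: i => [|i]; first by rewrite -k10.
  by have := kr i; rewrite !k0 mulr0 !addr0.
case: i => [|i].
  by have := kl j; rewrite IH1 !IH0 mulr0 !addr0.
by have := kw i j; rewrite !IH1 IH0 !addr0.
Qed.

End DiscreteWave.

Section Intertwiner.
Variables (R : realType) (H : realHilbertType R) (alpha : H -> H).
Local Notation C := R[i].
Local Notation HC := (complexification H).
Local Notation ci := (@complexification_inner R H).
Local Notation F := (fock_space H).
Local Notation Omega := (vacuum H).
Implicit Types (v w : seq HC) (x y z : HC) (e g : H).

Hypothesis alpha_orth : orthogonal_map alpha.
Variable zeta : F.
Hypothesis zeta_intertwines : forall eta (v : F),
  inner (semicircular (alpha eta) v) zeta = inner (right_semicircular eta v) zeta.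

Local Notation phi v := (inner (tensor v) zeta).

(** Approximate [zeta] by a finite combination of words; every longer word is orthogonal to it. *)
Lemma coefficient_decay (m : nat) : exists N, forall v, (N <= size v)%N ->
  `|phi v| <= `|(tensor v : F)| * m.+1%:R^-1.
Proof.
have [u hu] := @kernel_approx _ _ (PsdKernel (tensor_inner_psd H)) zeta.
have {hu} := hu m; set s := \sum_(p <- _) _ => hs.
exists (\max_(p <- u m) size p.2).+1 => v sv.
have vs : inner (tensor v) s = 0.
  rewrite inner_sumr big_seq big1 // => p pu; rewrite innerZr.
  rewrite [inner _ _]tensorE tensor_inner_size ?mulr0 //.
  rewrite gtn_eqF // (leq_trans _ sv) // ltnS.
  by rewrite (big_rem p) //= leq_maxl.
have -> : phi v = inner (tensor v) (zeta - s) by rewrite innerBr vs subr0.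
by apply: le_trans (inner_CS _ _) _; rewrite ler_wpM2l.
Qed.

Lemma coefficient_lin v w (a : C) x y :
  phi (v ++ (a *: x + y) :: w) = a * phi (v ++ x :: w) + phi (v ++ y :: w).
Proof. by rewrite tensor_multilinear innerDl innerZl. Qed.

Lemma coefficient_rel_nil eta :
  phi [:: complexify (alpha eta)] = phi [:: complexify eta].
Proof.
have := zeta_intertwines eta Omega.
by rewrite semicircular_nil right_semicircular_nil.
Qed.

(* The same word is written once from the left and once from the right. *)
Lemma coefficient_rel eta x v w y : x :: v = rcons w y ->
  phi (complexify (alpha eta) :: x :: v) + ci x (complexify (alpha eta)) * phi v =
  phi (rcons (rcons w y) (complexify eta)) + ci y (complexify eta) * phi w.
Proof.
move=> xv; have := zeta_intertwines eta (tensor (x :: v)).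
rewrite semicircular_cons innerDl innerZl => ->.
by rewrite xv right_semicircular_rcons innerDl innerZl.
Qed.

Lemma norm_tensor_cons x v : ci x x = 1 ->
  `|(tensor (x :: v) : F)| = `|(tensor v : F)|.
Proof.
move=> x1; apply/eqP; rewrite -(@eqrXn2 _ 2) //.
by rewrite -!inner_norm !tensorE /= x1 mul1r.
Qed.

Lemma norm_tensor_rcons x v : ci x x = 1 ->
  `|(tensor (rcons v x) : F)| = `|(tensor v : F)|.
Proof.
move=> x1; apply/eqP; rewrite -(@eqrXn2 _ 2) //.
by rewrite -!inner_norm !tensorE tensor_inner_rcons x1 mul1r.
Qed.

Section UnitVector.
Variable e : H.
Hypothesis e1 : inner e e = 1.
Local Notation E := (complexify e).
Local Notation G := (complexify (alpha e)).

Lemma cinner_unit : ci E E = 1.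
Proof. by rewrite cinner_real e1. Qed.

Lemma cinner_unit_image : ci G G = 1.
Proof. by rewrite cinner_real alpha_orth.2 e1. Qed.

Lemma cat_nseqSr v j : v ++ nseq j.+1 E = rcons (v ++ nseq j E) E.
Proof. by rewrite rcons_cat; congr cat; elim: j => //= j ->. Qed.

(** Unit letters keep the norm, so the decay estimate has a constant independent of [i] and [j]. *)
Lemma norm_sandwich v i j :
  `|(tensor (nseq i G ++ v ++ nseq j E) : F)| = `|(tensor v : F)|.
Proof.
elim: i => [|i IH]; last by rewrite norm_tensor_cons // cinner_unit_image.
elim: j => [|j IH]; first by rewrite cats0.
by rewrite cat_nseqSr norm_tensor_rcons // cinner_unit.
Qed.

Lemma sandwich_decay v m : exists N, forall i j, (N <= i + j)%N ->
  `|phi (nseq i G ++ v ++ nseq j E)| <= `|(tensor v : F)| * m.+1%:R^-1.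
Proof.
have [N hN] := coefficient_decay m; exists N => i j ij.
rewrite -(norm_sandwich v i j); apply: hN.
by rewrite !size_cat !size_nseq addnCA (leq_trans ij) // leq_addl.
Qed.

(** The boundary terms are the contractions of the outer letters of the core [x :: v] with [G] and
    [E]. They vanish, which is the wave equation with c = 0. *)
Lemma coefficient_sandwich_eq0 x v i j : ci x G = 0 -> ci (last x v) E = 0 ->
  phi (nseq i G ++ (x :: v) ++ nseq j E) = 0.
Proof.
move=> xG vE; move: i j.
have xv : x :: v = rcons (belast x v) (last x v) by rewrite lastI.
have key i0 := @coefficient_rel e i0.
apply: (@discrete_wave_eq0 _ (fun i j => phi (nseq i G ++ (x :: v) ++ nseq j E)) 0
  `|(tensor (x :: v) : F)|).
- by rewrite eq_sym oner_eq0.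
- have := key x v _ _ xv; rewrite xG vE !mul0r !addr0 /= cats0 => ->.
  by rewrite -xv cats1.
- move=> j; have := key x (v ++ nseq j.+1 E) (x :: v ++ nseq j E) E.
  rewrite -cat_cons cat_nseqSr => /(_ erefl); rewrite xG cinner_unit !mul0r !addr0 mul1r.
  by rewrite -!cat_nseqSr /= => ->.
- move=> i; have := key G (nseq i G ++ x :: v) (G :: nseq i G ++ belast x v) (last x v).
  rewrite cinner_unit_image vE !mul0r mul1r !addr0 /= rcons_cat -xv => /(_ erefl).
  by rewrite /= !cats0 => ->; rewrite rcons_cat /= cats1.
- move=> i j; have := key G (nseq i G ++ (x :: v) ++ nseq j.+1 E)
    (G :: nseq i G ++ (x :: v) ++ nseq j E) E.
  rewrite cinner_unit_image cinner_unit !mul1r rcons_cons rcons_cat -cat_nseqSr.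
  move=> /(_ erefl) -> /=; congr (phi _ + _).
  rewrite !rcons_cat -[rcons (x :: _) E]/(rcons ((x :: v) ++ nseq j.+1 E) E).
  by rewrite -cat_nseqSr.
- exact: sandwich_decay.
Qed.

(** Without a core the powers of [G] and [E] meet, and the boundary terms carry their inner product
    [c]. *)
Lemma coefficient_ends_eq0 i j : alpha e <> e -> phi (nseq i G ++ nseq j E) = 0.
Proof.
move=> ae; move: i j; pose c := (inner e (alpha e))%:C%C : C.
have EG : ci E G = c by rewrite cinner_real.
have GE : ci G E = c by rewrite cinner_real rinnerC.
have key i0 := @coefficient_rel e i0.
apply: (@discrete_wave_eq0 _ (fun i j => phi (nseq i G ++ nseq j E)) c
  `|(tensor [::] : F)|).
(* For unit vectors |alpha e - e|^2 = 2 - 2c, so c = 1 would force alpha e = e. *)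
- apply/eqP => /(congr1 (@complex.Re R)) /= c1; apply: ae; apply/eqP.
  rewrite -subr_eq0; apply/eqP/rinner_eq0.
  rewrite !(rinnerBl, rinnerBr) alpha_orth.2 (rinnerC (alpha e)) c1 e1.
  by ring.
- exact: coefficient_rel_nil.
- move=> j; have xE : E :: nseq j E = rcons (nseq j E) E := cat_nseqSr [::] j.
  have := key E (nseq j E) (nseq j E) E xE; rewrite EG cinner_unit mul1r => h.
  by apply: etrans h _; rewrite -xE /= -xE.
- move=> i; have := key G (nseq i G) (nseq i G) G.
  have -> : rcons (nseq i G) G = G :: nseq i G by elim: (i) => //= n ->.
  move=> /(_ erefl); rewrite GE cinner_unit_image mul1r /= !cats0 => ->.
  by rewrite cats1.
- move=> i j; have := key G (nseq i G ++ nseq j.+1 E) (G :: nseq i G ++ nseq j E) E.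
  rewrite rcons_cons -cat_nseqSr => /(_ erefl).
  rewrite cinner_unit cinner_unit_image !mul1r => h.
  by apply: etrans h _; rewrite rcons_cons -cat_nseqSr.
- exact: (sandwich_decay [::]).
Qed.

(** Outer letters are split into a part along [G] or [E], absorbed by the outer powers, and an
    orthogonal part, until the sandwich lemma applies. The vacuum coefficient is left aside, as it
    may survive when [alpha] is the identity. *)
Lemma coefficient_eq0 v :
  (forall i j, (0 < i + j)%N -> phi (nseq i G ++ nseq j E) = 0) ->
  (0 < size v)%N -> phi v = 0.
Proof.
move=> ends.
(* A single letter must be made orthogonal to both [G] and [E]: subtract its component along [E'],
   the part of [E] orthogonal to [G]. The words containing [E'] in its place reduce to [ends]. *)
have one i j x : ci x G = 0 -> phi (nseq i G ++ x :: nseq j E) = 0.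
  move=> xG; pose c : C := ci E G.
  pose E' := (- c) *: G + E.
  have E'G : ci E' G = 0 by rewrite cinnerDl cinnerZl cinner_unit_image mulr1 addNr.
  have xEE : ci x E = ci x E'.
    rewrite -[LHS]cinnerC -[RHS]cinnerC; congr (_^*).
    by rewrite cinnerDl cinnerZl -[ci G x]cinnerC xG conjC0 mulr0 add0r.
  (* If [E'] is null, [x] is already orthogonal to [E]. *)
  have [E0|E0] := eqVneq (ci E' E') 0.
    apply: (@coefficient_sandwich_eq0 x [::] i j) => //=; rewrite xEE.
    exact: cinner_null.
  pose t := ci x E' / ci E' E'.
  pose z := (- t) *: E' + x.
  have -> : x = t *: E' + z by rewrite /z scaleNr addNKr.
  rewrite coefficient_lin /E' coefficient_lin.
  rewrite -[nseq i G ++ E :: _]/(nseq i G ++ nseq j.+1 E) ends ?addnS //.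
  have -> : nseq i G ++ G :: nseq j E = nseq i.+1 G ++ nseq j E.
    by rewrite -cat_rcons; congr cat; elim: (i) => //= n ->.
  rewrite ends // mulr0 addr0 mulr0 add0r.
  apply: (@coefficient_sandwich_eq0 z [::] i j) => /=.
    by rewrite cinnerDl cinnerZl E'G xG mulr0 addr0.
  have zE' : ci z E' = 0 by rewrite cinnerDl cinnerZl /t mulNr divfK // addNr.
  have zG : ci z G = 0 by rewrite cinnerDl cinnerZl E'G xG mulr0 addr0.
  have -> : E = c *: G + E' by rewrite /E' scaleNr addNKr.
  rewrite -cinnerC cinnerDl cinnerZl -[ci G z]cinnerC -[ci E' z]cinnerC zG zE'.
  by rewrite !conjC0 mulr0 addr0 conjC0.
(* Work from the right: the [E] part of the last letter raises [j] and shortens the core, while the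
   remainder closes the sandwich. *)
have left i j x w : ci x G = 0 -> phi (nseq i G ++ (x :: w) ++ nseq j E) = 0.
  move=> xG; elim/last_ind: w j => [|w y IH] j; first exact: one.
  pose c : C := ci y E; pose z := y - c *: E.
  have -> : y = c *: E + z by rewrite /z addrC subrK.
  rewrite -cats1 -cat_cons -catA catA coefficient_lin.
  rewrite -!catA -[(x :: w) ++ E :: _]/((x :: w) ++ nseq j.+1 E) IH mulr0 add0r.
  have -> : (x :: w) ++ z :: nseq j E = (x :: rcons w z) ++ nseq j E.
    by rewrite /= cat_rcons.
  apply: coefficient_sandwich_eq0 => //; rewrite last_rcons.
  by rewrite cinnerBl cinnerZl cinner_unit mulr1 subrr.
(* Work from the left: the [G] part of the first letter raises [i], and the remainder is handled by
   [left]. *)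
have all i w : (0 < i + size w)%N -> phi (nseq i G ++ w) = 0.
  elim: w i => [|y w IH] i.
    by move=> i0; rewrite -[[::]]/(nseq 0 E); exact: ends.
  move=> _; pose c : C := ci y G; pose z := y - c *: G.
  have -> : y = c *: G + z by rewrite /z addrC subrK.
  rewrite coefficient_lin.
  have -> : nseq i G ++ G :: w = nseq i.+1 G ++ w.
    by rewrite -cat_rcons; congr cat; elim: (i) => //= n ->.
  rewrite IH // mulr0 add0r -[z :: w]cats0; apply: (left i 0%N).
  by rewrite cinnerBl cinnerZl cinner_unit_image mulr1 subrr.
by move=> v0; exact: (all 0%N).
Qed.

End UnitVector.

End Intertwiner.

Section Intertwiners.
Variables (R : realType) (H : realHilbertType R).
Local Notation C := R[i].
Local Notation F := (fock_space H).
Local Notation Omega := (vacuum H).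
Implicit Types (alpha : H -> H) (zeta : F).

Definition intertwiner alpha zeta := forall eta (v : F),
  inner (semicircular (alpha eta) v) zeta = inner (right_semicircular eta v) zeta.

Lemma inner_normalized (x : H) : x != 0 ->
  inner (`|x|^-1 *: x) (`|x|^-1 *: x) = 1.
Proof.
rewrite -normr_eq0 => x0; rewrite rinnerZl rinnerZr inner_norm.
by field.
Qed.

Lemma intertwiner_eq0 alpha zeta : orthogonal_map alpha -> alpha <> id ->
  intertwiner alpha zeta -> zeta = 0.
Proof.
move=> oa aid hz.
have [e e1 ae] : exists2 e, inner e e = 1 & alpha e <> e.
  have [x ax] : exists x, alpha x <> x.
    apply: contrapT => /forallNP h; apply: aid; apply/funext => x.
    by apply: contrapT; exact: h.
  have x0 : x != 0.
    by apply/eqP => x0; apply: ax; rewrite x0; exact: (lin0 oa.1).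
  exists (`|x|^-1 *: x); first exact: inner_normalized.
  rewrite (linZ oa.1) => /(congr1 (fun y => `|x| *: y)).
  by rewrite !scalerA mulfV ?normr_eq0 // !scale1r.
apply: tensor_ext => -[|x v]; rewrite inner0l -innerC.
  by rewrite (coefficient_ends_eq0 oa hz e1 0 0 ae) conjC0.
rewrite (coefficient_eq0 oa hz e1) ?conjC0 // => i j _.
exact: coefficient_ends_eq0.
Qed.

Lemma intertwiner_id zeta (e g : H) :
  inner e e = 1 -> inner g g = 1 -> inner e g = 0 ->
  intertwiner id zeta -> zeta = inner zeta Omega *: Omega.
Proof.
move=> e1 g1 eg hz; have oid : orthogonal_map (@id H) by [].
apply: tensor_ext => -[|x v]; rewrite innerZl tensorE ?mulr1 //=.
rewrite mulr0 -innerC (coefficient_eq0 oid hz e1) ?conjC0 // => i j ij.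
rewrite -nseqD; case: (i + j)%N ij => [//|n] _.
(* The sandwich lemma for the unit vector [g], with no outer letters: a positive power of [e] starts
   and ends orthogonally to [g]. *)
have := @coefficient_sandwich_eq0 _ _ _ oid zeta hz g g1 (complexify e)
  (nseq n (complexify e)) 0%N 0%N.
have Eg : complexification_inner (complexify e) (complexify g) = 0 :> C.
  by rewrite cinner_real eg.
have -> : last (complexify e) (nseq n (complexify e)) = complexify e by elim: n.
by rewrite cats0; apply.
Qed.

(** Dimension at least 2: in dimension 0 already pi 1 = id, and in dimension 1 the map pi 1 is a
    sign, so pi 2 = id. *)
Lemma faithful_orthonormal_pair (pi : int -> H -> H) :
  orthogonal_representation pi -> faithful_representation pi ->
  exists e g : H, [/\ inner e e = 1, inner g g = 1 & inner e g = 0].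
Proof.
move=> hpi faith.
have [x0 hx0] : exists x : H, x != 0.
  apply: contrapT => /forallNP h; apply: (faith 1) => //; apply/funext => x.
  have all0 y : y = 0 :> H by apply/eqP; apply: contrapT => /negP; exact: h.
  by rewrite (all0 x) [LHS]all0.
have [e e1] : exists e : H, inner e e = 1.
  by exists (`|x0|^-1 *: x0); exact: inner_normalized.
suff [g g0 eg] : exists2 g : H, g != 0 & inner e g = 0.
  exists e, (`|g|^-1 *: g); split=> //; first exact: inner_normalized.
  by rewrite rinnerZr eg mulr0.
apply: contrapT => /forall2NP h.
have span x : x = inner x e *: e.
  apply/eqP; rewrite -subr_eq0; have [/negP/negPn//|] := h (x - inner x e *: e).
  by rewrite rinnerBr rinnerZr e1 mulr1 rinnerC subrr.
apply: (faith (1 + 1)) => //; apply/funext => x.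
have lpi := representation_linear hpi 1.
have [a pe] : exists a, pi 1 e = a *: e by exists (inner (pi 1 e) e).
have a2 : a * a = 1.
  have := representation_isometry hpi 1 e e.
  by rewrite pe rinnerZl rinnerZr e1 mulr1.
have fix_e c : pi (1 + 1) (c *: e) = c *: e.
  rewrite (representationD hpi) /=.
  by rewrite !(linZ lpi, pe) !scalerA -mulrA a2 mulr1.
by rewrite (span x) fix_e.
Qed.

End Intertwiners.

(** * Faithfulness and factoriality *)

Section Main.
Variables (R : realType) (H : realHilbertType R) (pi : int -> H -> H).
Hypothesis hpi : orthogonal_representation pi.

Lemma faithful_factor : faithful_representation pi ->
  is_factor (free_gaussian_crossed_product pi).
Proof.
move=> faith; have [e [g [e1 g1 eg]]] := faithful_orthonormal_pair hpi faith.
apply/seteqP; split=> [T [MT cT]|_ [c ->]]; last first.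
  split; first exact: generated_scalar.
  by apply: commutant_scalar => A; exact: generated_bounded.
set z := T (delta 0 (vacuum H)).
have [zeta [z0 h0]] := central_coefficient hpi 0 MT cT.
exists (inner zeta (vacuum H)); apply: (central_scalar hpi) => //.
(* Compare coordinates: at 0 the intertwiner belongs to the identity and is a multiple of the
   vacuum; at n <> 0 it vanishes because pi (- n) <> id. *)
apply: ltwo_ext => n v; rewrite -innerC -[RHS]innerC; congr (_^*).
rewrite innerZr deltaE; have [->|n0] := eqVneq n 0.
  have zE : zeta = inner zeta (vacuum H) *: vacuum H.
    apply: (intertwiner_id e1 g1 eg) => eta u.
    by have := h0 eta u; rewrite oppr0 (representation0 hpi).
  by rewrite -z0 mul1r [in LHS]zE innerZr.
have [zn [hzn hn]] := central_coefficient hpi n MT cT.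
rewrite -hzn (intertwiner_eq0 (orthogonal_pi hpi (- n)) _ hn).
  by rewrite inner0r mul0r mulr0.
by apply: faith; rewrite oppr_eq0.
Qed.

End Main.

Theorem corollary3p10 (R : realType) (H : realHilbertType R)
    (pi : int -> H -> H) (hpi : orthogonal_representation pi) :
  is_factor (free_gaussian_crossed_product pi) <-> faithful_representation pi.
Proof. by split; [exact: factor_faithful | exact: faithful_factor]. Qed.
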